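(* Let $K$ be a field of characteristic $0$, $F(t)=\sum_{n\ge0}a_nt^n\in K[[t]]$ with $a_0=1$, write $\log F(t)=\sum_{n\ge1}b_n\frac{t^n}{n}$, and define $R_n$ by $\sum_{n\ge0}R_nt^n=\prod_{i\ge1}F(x_it)$. Then: (a) $[s_n]R_n=a_n$ for all $n$, i.e. $\sum_{n\ge0}[s_n]R_nt^n=F(t)$. Moreover, for any homogeneous symmetric function $f$ of degree $n$, $[s_n]f$ equals the sum of the coefficients in the $h$-expansion of $f$. (b) $\sum_{n\ge0}[s_{1^n}]R_nt^n=\frac{1}{F(-t)}$. (c) For fixed $k\ge1$, $\sum_{n\ge0}[h_k^n]R_{kn}\,t^n=\exp\left(-\sum_{i\ge1}b_{ki}\frac{(-t)^i}{i}\right)$, i.e. $1/F(-t)$ with each $b_i$ replaced by $b_{ki}$. In particular $[h_n]R_n=b_n$. (d) If $i,j\ge1$ and $i+j=n$, then $[h_ih_j]R_n=b_ib_j-b_n$ if $i\ne j$, and $[h_ih_j]R_n=\frac12(b_i^2-b_n)$ if $i=j$. (e) For $k\ge 0$, $\sum_{n\ge0}R_n(1^k)t^n=F(t)^k$, where $R_n(1^k)$ denotes $R_n$ evaluated at $x_1=\cdots=x_k=1$, $x_{k+1}=x_{k+2}=\cdots=0$. (f) Let $u$ be an indeterminate and write $\frac{F(t)}{F(-ut)}=\sum_{n\ge0}P_n(u)t^n$. Then for $n\ge1$, $P_n(u)$ is a polynomial in $u$ of degree at most $n$ divisible by $1+u$, and $$\frac{P_n(u)}{1+u}=\sum_{k=0}^{n-1}\left([s_{(n-k,1^k)}]R_n\right)u^k,$$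 where $(n-k,1^k)$ denotes the hook partition with one part $n-k$ and $k$ parts equal to $1$.
   Context: For a basis $\{b_\lambda\}$ of symmetric functions, $[b_\lambda]f$ is the coefficient of $b_\lambda$ in the expansion of $f$. $s_\lambda$ are Schur functions, $h_\lambda$ complete homogeneous symmetric functions; $h_k^n$ means $h_{(k,k,\dots,k)}$ with $n$ parts, $s_n=s_{(n)}$, $s_{1^n}=s_{(1,\dots,1)}$. *)

(* Defs.v *)
From mathcomp Require Import all_boot all_order all_algebra.
From mathcomp Require Import mpoly.
From Stdlib Require Import ClassicalEpsilon.

Set Implicit Arguments.
Unset Strict Implicit.
Unset Printing Implicit Defensive.

Import GRing.Theory.
Local Open Scope ring_scope.

(** * Formal power series *)

(* A series sum_n (f n) t^n in A[[t]] is its coefficient sequence f. *)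
Definition fps (A : comNzRingType) := nat -> A.

Section PowerSeries.
Variable A : comNzRingType.
Implicit Types (f g c : fps A).

Definition fps_one : fps A := fun n => (n == 0%N)%:R.
Definition fps_add f g : fps A := fun n => f n + g n.
Definition fps_opp f : fps A := fun n => - f n.
Definition fps_mul f g : fps A := fun n => \sum_(i < n.+1) f i * g (n - i)%N.
Definition fps_pow f k : fps A := iter k (fps_mul f) fps_one.

(* f(z t) *)
Definition fps_dil (z : A) f : fps A := fun n => z ^+ n * f n.

(* sum_m (c m) g(t)^m, for g with zero constant term: as g^m has order >= m,
   only the terms m <= n contribute to t^n. *)
Definition fps_comp c g : fps A :=
  fun n => \sum_(m < n.+1) c m * fps_pow g m n.

(* 1/f = sum_m (1 - f)^m, for f with constant term 1. *)
Definition fps_inv f : fps A :=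
  fps_comp (fun=> 1) (fps_add fps_one (fps_opp f)).

End PowerSeries.

Section ExpLog.
Variable K : fieldType.

(* exp g, for g with zero constant term. *)
Definition fps_exp (g : fps K) : fps K := fps_comp (fun m => (m`!%:R)^-1) g.

(* log f = sum_(m >= 1) (-1)^(m-1) (f - 1)^m / m, for f with constant term 1. *)
Definition fps_log (f : fps K) : fps K :=
  fps_comp (fun m => if m is m'.+1 then (-1) ^+ m' / m%:R else 0)
           (fps_add f (fps_opp (fps_one K))).

(* The series sum_(i >= 1) (b i) t^i / i. *)
Definition fps_logser (b : nat -> K) : fps K :=
  fun i => if i is 0 then 0 else b i / i%:R.

End ExpLog.

(** * Partitions and symmetric functions *)

Definition is_partn (n : nat) (l : seq nat) : bool :=
  [&& sorted geq l, 0%N \notin l & sumn l == n].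

(* The partition (n), which is the empty partition when n = 0. *)
Definition row_partn (n : nat) : seq nat := if n is 0 then [::] else [:: n].

(* The list of all partitions of n: such a partition has at most n parts, all at
   most n. *)
Definition partns (n : nat) : seq (seq nat) :=
  [seq l <- [seq map val t | t : {bseq n of 'I_n.+1}] | is_partn n l].

Lemma partns_uniq n : uniq (partns n).
Proof.
rewrite filter_uniq // map_inj_uniq ?enum_uniq // => s t /inj_map eq_st.
by apply/val_inj/eq_st/val_inj.
Qed.

Lemma mem_partns n l : (l \in partns n) = is_partn n l.
Proof.
rewrite mem_filter; case: (boolP (is_partn n l)) => //= /and3P[_ l0 /eqP suml].
have lt_l k : k \in l -> (k < n.+1)%N.
  move=> kl; rewrite ltnS -suml sumnE (perm_big _ (perm_to_rem kl)) big_cons.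
  exact: leq_addr.
have size_l : (size l <= n)%N.
  rewrite -suml {lt_l suml}; elim: l l0 => //= k l IHl.
  by rewrite inE negb_or eq_sym -lt0n => /andP[k0 /IHl le_l]; rewrite -add1n leq_add.
have size_s : (size [seq inord k : 'I_n.+1 | k <- l] <= n)%N by rewrite size_map.
apply/mapP; exists (Bseq size_s); first exact: mem_enum.
rewrite /= -map_comp map_id_in // => k /lt_l lt_k /=.
by rewrite inordK.
Qed.

Section SymmetricFunctions.
Variable K : fieldType.

(* The ring of symmetric functions is taken as the inverse limit of the rings of
   symmetric polynomials: f N is f(x_1, ..., x_N, 0, 0, ...). *)
Definition varfam := forall N : nat, {mpoly K[N]}.

Definition drop_last_var N (p : {mpoly K[N.+1]}) : {mpoly K[N]} :=
  p \mPo [tuple oapp (fun j : 'I_N => 'X_j) 0 (unlift ord_max i) | i < N.+1].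

Definition homog_symfun (n : nat) (f : varfam) : Prop :=
  [/\ forall N, f N \is symmetric,
      forall N, f N \is n.-homog
    & forall N, drop_last_var (f N.+1) = f N].

(* f(1^k): x_1 = ... = x_k = 1 and x_i = 0 for i > k. *)
Definition eval_ones (k : nat) (f : varfam) : K := (f k).@[fun=> 1].

Definition hsym (k : nat) : varfam :=
  fun N => \sum_(m : 'X_{1..N < k.+1} | mdeg m == k) 'X_[m].

Definition hfun (l : seq nat) : varfam := fun N => \prod_(k <- l) hsym k N.

(* Cells (i, j) of the Young diagram of l: row i, column j, from 0. *)
Definition cell (l : seq nat) : finType :=
  {p : 'I_(size l) * 'I_(head 0%N l) | (p.2 < nth 0%N l p.1)%N}.

Definition is_ssyt (l : seq nat) N (T : {ffun cell l -> 'I_N}) : bool :=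
  [forall p : cell l, forall q : cell l,
     let: (i, j) := val p in let: (i', j') := val q in
     ((i == i') && (j <= j')%N ==> (T p <= T q)%N) &&
     ((j == j') && (i < i')%N ==> (T p < T q)%N)].

Definition schur (l : seq nat) : varfam :=
  fun N => \sum_(T : {ffun cell l -> 'I_N} | is_ssyt T) \prod_(p : cell l) 'X_(T p).

Definition is_expansion (b : seq nat -> varfam) (n : nat) (f : varfam)
    (c : seq nat -> K) : Prop :=
  forall N, f N = \sum_(l <- partns n) c l *: b l N.

(* [b_l] f for f homogeneous of degree n and l a partition of n: the l-th
   coefficient of the expansion of f in (b_m), m ranging over the partitions of
   n. The choice of c is irrelevant when (b_m) is a basis in degree n. *)
Definition bcoef (b : seq nat -> varfam) (n : nat) (f : varfam) (l : seq nat) : K :=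
  epsilon (inhabits (fun=> 0)) (is_expansion b n f) l.

(* R_n, the coefficient of t^n in prod_(i >= 1) F(x_i t). As F(0) = 1, putting
   x_i = 0 for all i > N leaves the product over i <= N, in K[x_1,...,x_N][[t]]. *)
Definition Rfun (F : fps K) (n : nat) : varfam :=
  fun N => (\big[@fps_mul {mpoly K[N]}/fps_one {mpoly K[N]}]_(i < N)
              fps_dil 'X_i (fun m => (F m)%:MP)) n.

End SymmetricFunctions.

(* Main.v *)
(* Write p_k for the power sums. Since t F'(t) = F(t) sum_k b_k t^k, one gets
   n R_n = sum_(k >= 1) b_k p_k R_(n-k); for F = 1/(1-t) and F = 1+t these are the
   Newton identities for h_n and e_n. Together with the fundamental theorem of
   symmetric polynomials they show that the h_l span in each degree and that any
   prescribed values of the h_k extend to a ring morphism, whose value on R_n is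
   given by the recursion. Sending h_k to 1 and the other h_j to 0 gives (c);
   sending h_i and h_j to X and the others to 0, and reading off X^2, gives (d).

   For Schur functions, removing the largest entry of a tableau matches the
   expansion of an alternant obtained by column operations, which yields the
   bialternant formula a_delta s_l = a_(l + delta). Hence Schur functions are
   symmetric and linearly independent, and [s_l] f is the coefficient of
   x^(l + delta) in a_delta f. For f = R_n this is the determinant of
   a_(l_i - i + j), whose first column has two nonzero entries when l is a hook;
   the resulting recursion gives (b) and (f). Part (a) is the one-variable case. *)

Require Import Defs.
From mathcomp Require Import all_boot all_order all_algebra.
From mathcomp Require Import fingroup perm mpoly zify ring.
From Stdlib Require Import FunctionalExtensionality ClassicalEpsilon.

Set Implicit Arguments.
Unset Strict Implicit.
Unset Printing Implicit Defensive.

Import GRing.Theory.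
Local Open Scope ring_scope.

(** * Formal power series *)

Section FpsTheory.
Variable A : comNzRingType.
Implicit Types (f g h c : fps A).

(** A coefficient [bcoef] is an arbitrary choice among expansions, so each coefficient formula is
    proved for every expansion [c]; the formula is itself the uniqueness. An expansion must hold for
    all numbers of variables at once. Both of its sides are stable families, so it suffices to find
    it in n variables, n being the degree.

    The fundamental theorem makes e_1, ..., e_N free generators in N variables, whereas values are
    prescribed on the h_k. The series of values of the e_k is 1/eta(-t), and this is checked through
    power sums, to which both Newton recursions are linked. Only the h_k with k <= N receive the
    prescribed value, which is enough in degree n when N = n. Specializations take values in
    [{poly K}] because a variable X that counts parts separates h_i h_j from other products of h_i
    and h_j of the same degree.

    Series are compared by logarithmic derivatives: in characteristic 0 the derivative and the
    constant term 1 determine a series, so identities between exp, log and inverse reduce to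
    identities of derivatives. *)

Definition fps_trunc M f : {poly A} := \poly_(i < M) f i.

(** A coefficient of a product involves finitely many coefficients of the factors, so the ring laws
    of series can be borrowed from [{poly A}]. *)
Lemma coef_truncM M f g n :
  (n < M)%N -> (fps_trunc M f * fps_trunc M g)`_n = fps_mul f g n.
Proof.
move=> ltnM; rewrite coefM; apply: eq_bigr => i _; rewrite !coef_poly.
have lein : (i <= n)%N by rewrite -ltnS.
by rewrite (leq_ltn_trans lein ltnM) (leq_ltn_trans (leq_subr _ _) ltnM).
Qed.

(** Iterated products need this form: a product of truncations is no longer a truncation, but still
    agrees with the series below degree [M]. *)
Lemma coef_mul_trunc M f (p : {poly A}) :
  (forall n, (n < M)%N -> p`_n = f n) ->
  forall g n, (n < M)%N -> (p * fps_trunc M g)`_n = fps_mul f g n.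
Proof.
move=> eq_pf g n ltnM; rewrite coefM; apply: eq_bigr => i _.
have lein : (i <= n)%N by rewrite -ltnS.
rewrite eq_pf ?(leq_ltn_trans lein ltnM) // coef_poly.
by rewrite (leq_ltn_trans (leq_subr _ _) ltnM).
Qed.

Lemma fps_mulC f g : fps_mul f g = fps_mul g f.
Proof.
apply: functional_extensionality => n.
by rewrite -(@coef_truncM n.+1) // mulrC coef_truncM.
Qed.

Lemma fps_mulA f g h : fps_mul f (fps_mul g h) = fps_mul (fps_mul f g) h.
Proof.
apply: functional_extensionality => n.
pose T := fps_trunc n.+1.
have eqT f1 f2 k : (k < n.+1)%N -> (T f1 * T f2)`_k = fps_mul f1 f2 k.
  exact: coef_truncM.
rewrite -(coef_mul_trunc (eqT f g)) // -mulrA [T f * _]mulrC.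
by rewrite fps_mulC -(coef_mul_trunc (eqT g h)).
Qed.

Lemma fps_mul1 f : fps_mul (fps_one A) f = f.
Proof.
apply: functional_extensionality => n.
rewrite /fps_mul big_ord_recl /= subn0 mul1r big1 ?addr0 // => i _.
by rewrite /fps_one /= mul0r.
Qed.

Lemma fps_mulDl f g h :
  fps_mul (fps_add f g) h = fps_add (fps_mul f h) (fps_mul g h).
Proof.
apply: functional_extensionality => n.
by rewrite /fps_add /fps_mul -big_split; apply: eq_bigr => i _; rewrite mulrDl.
Qed.

Lemma coef_truncX M f m n :
  (n < M)%N -> (fps_trunc M f ^+ m)`_n = fps_pow f m n.
Proof.
elim: m n => [|m IHm] n ltnM; first by rewrite expr0 coef1.
by rewrite exprSr (coef_mul_trunc IHm) //= fps_mulC.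
Qed.

Lemma coefM_expr0 (p q : {poly A}) M n :
  q`_0 = 0 -> (n < M)%N -> (p * q ^+ M)`_n = 0.
Proof.
move=> q0 ltnM; have [r ->] : exists r, q = r * 'X.
  exists (\poly_(i < size q) q`_i.+1); apply/polyP=> i.
  rewrite coefMX coef_poly; case: i => [//|i] /=; case: ltnP => // leqi.
  by rewrite nth_default // (leq_trans leqi).
by rewrite exprMn mulrA coefMXn ltnM.
Qed.

(** The extra terms n < m < M vanish because g^m has order at least m. A single polynomial thus
    carries all coefficients below [M]. *)
Lemma coef_trunc_comp M c g n :
    g 0%N = 0 -> (n < M)%N ->
  (\sum_(m < M) c m *: fps_trunc M g ^+ m)`_n = fps_comp c g n.
Proof.
move=> g0 ltnM; rewrite coef_sum /fps_comp.
rewrite (big_ord_widen M (fun m => c m * fps_pow g m n)) // [RHS]big_mkcond /=.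
apply: eq_bigr => m _; rewrite coefZ coef_truncX //; case: ltnP => // ltnm.
rewrite -(@coef_truncX M) // -[_ ^+ m]mul1r coefM_expr0 ?mulr0 //.
by rewrite coef_poly (leq_ltn_trans _ ltnM).
Qed.

(** With g = 1 - f, the geometric sum (1 - g)(1 + g + ... + g^n) = 1 - g^(n+1) agrees with 1 up to
    degree n. *)
Lemma fps_mulV f : f 0%N = 1 -> fps_mul f (fps_inv f) = fps_one A.
Proof.
move=> f0; apply: functional_extensionality => n; rewrite /fps_inv; set g := fps_add _ _.
have g0 : g 0%N = 0 by rewrite /g /fps_add /fps_opp f0 subrr.
rewrite fps_mulC -(coef_mul_trunc (M := n.+1) (p := \sum_(m < n.+1) fps_trunc n.+1 g ^+ m) _ f) //;
    last first.
  move=> k ltkn; rewrite -(@coef_trunc_comp n.+1) // !coef_sum.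
  by apply: eq_bigr => m _; rewrite coefZ mul1r.
have ->: fps_trunc n.+1 f = 1 - fps_trunc n.+1 g.
  apply/polyP=> i; rewrite coefB !coef_poly coef1 /g /fps_add /fps_opp /fps_one.
  by case: ltnP; [rewrite opprB addrC subrK|case: i => [|i]//; rewrite subr0].
rewrite mulrC -opprB mulNr -subrX1 opprB coefB coef1 -[_ ^+ _]mul1r.
by rewrite coefM_expr0 ?subr0 // coef_poly.
Qed.

Lemma fps_inv_unique f g :
  f 0%N = 1 -> fps_mul f g = fps_one A -> g = fps_inv f.
Proof.
move=> f0 fg1; rewrite -[LHS]fps_mul1 -(fps_mulV f0) fps_mulC fps_mulA.
by rewrite [fps_mul g f]fps_mulC fg1 fps_mul1.
Qed.

(* [fps_logder f c] says that t f'(t) = c(t) f(t). *)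
Definition fps_logder f c := forall n, n%:R * f n = fps_mul c f n.

Lemma fps_logderM f g c d :
  fps_logder f c -> fps_logder g d -> fps_logder (fps_mul f g) (fps_add c d).
Proof.
move=> fc gd n; pose th h : fps A := fun n => n%:R * h n.
have thf : fps_mul c f = th f by apply: functional_extensionality => m; rewrite -fc.
have thg : fps_mul d g = th g by apply: functional_extensionality => m; rewrite -gd.
rewrite fps_mulDl fps_mulA thf [fps_mul f g]fps_mulC fps_mulA thg [fps_mul (th g) f]fps_mulC.
rewrite /fps_add [fps_mul g f]fps_mulC mulr_sumr -big_split; apply: eq_bigr => i _ /=.
have -> : n%:R = i%:R + (n - i)%:R :> A by rewrite -natrD subnKC // -ltnS.
by rewrite /th mulrDl -mulrA [(n - i)%:R * _]mulrCA.
Qed.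

Lemma fps_logder_one : fps_logder (fps_one A) (fun=> 0).
Proof.
move=> n; rewrite /fps_mul big1 => [|i _]; last by rewrite mul0r.
by rewrite /fps_one; case: n => [|n]; rewrite ?mul0r ?mulr0.
Qed.

Lemma fps_logder_dil z f c : fps_logder f c -> fps_logder (fps_dil z f) (fps_dil z c).
Proof.
move=> fc n; rewrite /fps_dil mulrCA fc mulr_sumr; apply: eq_bigr => i _.
have {1}-> : n = (i + (n - i))%N by rewrite subnKC // -ltnS.
by rewrite exprD mulrACA.
Qed.

(** Apply [th], that is t d/dt, to f (1/f) = 1: then f (th(1/f) + c/f) = 0, and f cancels since it
    is invertible. *)
Lemma fps_logder_inv f c :
  f 0%N = 1 -> fps_logder f c -> fps_logder (fps_inv f) (fps_opp c).
Proof.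
move=> f0 fc n; pose th h : fps A := fun n => n%:R * h n.
have th0 : fps_mul f (fps_add (th (fps_inv f)) (fps_mul c (fps_inv f))) = fun=> 0.
  rewrite fps_mulC fps_mulDl fps_mulC; apply: functional_extensionality => m.
  rewrite /fps_add [fps_mul _ f]fps_mulC fps_mulA [fps_mul f c]fps_mulC.
  have -> : fps_mul c f = th f by apply: functional_extensionality => k; rewrite -fc.
  have <- : m%:R * fps_mul f (fps_inv f) m = 0.
    by rewrite fps_mulV // /fps_one; case: m => [|m]; rewrite ?mul0r ?mulr0.
  rewrite /fps_mul mulr_sumr -big_split; apply: eq_bigr => i _ /=.
  have -> : m%:R = i%:R + (m - i)%:R :> A by rewrite -natrD subnKC // -ltnS.
  rewrite /th mulrDl addrC -mulrA; congr (_ + _); last exact: mulrCA.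
have: fps_mul (fps_inv f) (fun=> 0) = fun=> 0.
  by apply: functional_extensionality => m; rewrite /fps_mul big1 // => i _; rewrite mulr0.
rewrite -{1}th0 fps_mulA [fps_mul _ f]fps_mulC fps_mulV // fps_mul1.
move/(congr1 (fun g : fps A => g n)); rewrite /fps_add => /eqP.
rewrite addr_eq0 => /eqP thn; rewrite -[LHS]/(th (fps_inv f) n) thn.
by rewrite /fps_mul -sumrN; apply: eq_bigr => i _; rewrite mulNr.
Qed.

(** The condition at n = 0 forces c 0 = 0, so only coefficients of [f] of index below [n] occur on
    the right: the equation becomes a recursion. *)
Lemma fps_logderE f c n :
  fps_logder f c -> f 0%N = 1 -> n%:R * f n = \sum_(k < n) c k.+1 * f (n - k.+1)%N.
Proof.
move=> fc f0; have c0 : c 0%N = 0.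
  by have := fc 0%N; rewrite mul0r /fps_mul big_ord1 f0 mulr1.
by rewrite fc /fps_mul big_ord_recl c0 mul0r add0r.
Qed.

End FpsTheory.

(** * Logarithm and exponential in characteristic 0 *)

Section FpsField.
Variable K : fieldType.
Hypothesis charK0 : [pchar K] =i pred0.
Implicit Types (f g : fps K).

Lemma natS_neq0 n : n.+1%:R != 0 :> K.
Proof. by rewrite ((pcharf0P K).1 charK0). Qed.

Lemma fps_logder_unique f g c :
  fps_logder f c -> fps_logder g c -> f 0%N = 1 -> g 0%N = 1 -> f = g.
Proof.
move=> fc gc f0 g0; apply: functional_extensionality => n.
elim/ltn_ind: n => -[|n] IHn; first by rewrite f0.
apply: (mulfI (natS_neq0 n)); rewrite (fps_logderE _ fc) // (fps_logderE _ gc) //.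
by apply: eq_bigr => k _; rewrite IHn // ltn_subrL.
Qed.

Lemma fps_logder_log f : f 0%N = 1 -> fps_logder f (fun n => n%:R * fps_log f n).
Proof.
move=> f0 [|k]; first by rewrite /fps_mul big_ord1 !mul0r.
set g := fps_add f (fps_opp (fps_one K)).
have g0 : g 0%N = 0 by rewrite /g /fps_add /fps_opp f0 subrr.
(* The coefficient at k + 1 is wanted; it is read off in degree k after differentiation, so degrees
   up to k + 1 must be kept. *)
pose M := k.+2; pose G := fps_trunc M g.
pose c m : K := if m is m'.+1 then (-1) ^+ m' / m%:R else 0.
pose L := \sum_(m < M) c m *: G ^+ m.
have L_E j : (j < M)%N -> L`_j = fps_log f j by apply: coef_trunc_comp.
have fE : fps_trunc M f = 1 + G.
  apply/polyP=> i; rewrite coefD !coef_poly coef1 /g /fps_add /fps_opp /fps_one.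
  by case: ltnP; [rewrite addrC subrK|case: i => [|i]//; rewrite addr0].
have G0 : (- G)`_0 = 0 by rewrite coefN coef_poly g0 oppr0.
(* Differentiating the logarithm series gives a geometric series in -G; the remainder has order
   above k. *)
have dL : L^`() * (1 + G) = G^`() - G^`() * (- G) ^+ k.+1.
  have -> : L^`() = (\sum_(m < k.+1) (- G) ^+ m) * G^`().
    rewrite /L big_ord_recl scale0r add0r raddf_sum mulr_suml; apply: eq_bigr => m _.
    rewrite /= -[bump 0 m]/m.+1 derivZ deriv_exp /= /c -scaler_nat scalerA.
    by rewrite divfK ?natS_neq0 // -[- G]scaleN1r exprZn -scalerAl mulrC.
  have geom : (\sum_(m < k.+1) (- G) ^+ m) * (1 + G) = 1 - (- G) ^+ k.+1.
    by rewrite -{2}[G]opprK mulrC -opprB mulNr -subrX1 opprB.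
  by rewrite mulrAC geom mulrBl mul1r [_ * G^`()]mulrC.
have := congr1 (fun p : {poly K} => p`_k) dL; rewrite coefB coefM_expr0 // subr0.
rewrite coef_deriv coef_poly leqnn /g /fps_add /fps_opp /fps_one subr0.
move=> dLk; rewrite mulr_natl -dLk fps_mulC coefM /fps_mul [RHS]big_ord_recr /=.
rewrite subnn mul0r mulr0 addr0.
rewrite [RHS](reindex_inj rev_ord_inj) /=; apply: eq_bigr => i _.
have lei : (i <= k)%N by rewrite -ltnS.
rewrite coef_deriv -fE coef_poly L_E // subSS mulrC.
rewrite ifT; last by rewrite ltnS (leq_trans (leq_subr _ _)).
by rewrite (subSn (leq_subr _ _)) subKn // mulr_natl.
Qed.

Lemma fps_logder_exp g : g 0%N = 0 -> fps_logder (fps_exp g) (fun n => n%:R * g n).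
Proof.
move=> g0 [|k]; first by rewrite /fps_mul big_ord1 !mul0r.
pose M := k.+2; pose G := fps_trunc M g.
pose L := \sum_(m < M) (m`!%:R)^-1 *: G ^+ m.
have L_E j : (j < M)%N -> L`_j = fps_exp g j.
  exact: (coef_trunc_comp (fun m => (m`!%:R)^-1)).
have G0 : G`_0 = 0 by rewrite coef_poly g0.
(* The derivative of the truncated exponential lacks the top term, which is of order above k. *)
have dL : L^`() = G^`() * L - ((k.+1)`!%:R^-1 *: G^`()) * G ^+ k.+1.
  rewrite {2}/L big_ord_recr /= mulrDr -scalerAr -scalerAl addrK.
  rewrite /L big_ord_recl derivD expr0 alg_polyC derivC add0r raddf_sum mulr_sumr.
  apply: eq_bigr => m _; rewrite /= -[bump 0 m]/m.+1 derivZ deriv_exp /=.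
  rewrite -scaler_nat scalerA factS natrM invfM mulrAC mulVf ?natS_neq0 // mul1r.
  by rewrite -scalerAr.
have := congr1 (fun p : {poly K} => p`_k) dL; rewrite coefB coefM_expr0 // subr0.
rewrite coef_deriv L_E // mulr_natl => ->.
rewrite /fps_mul big_ord_recl mul0r mul0r add0r coefM; apply: eq_bigr => i _ /=.
rewrite coef_deriv coef_poly ltnS (ltn_ord i) L_E ?mulr_natl //.
by rewrite ltnS (leq_trans (leq_subr _ _)).
Qed.

End FpsField.

(** * The symmetric functions R_n *)

Lemma coef_trunc_prod (A : comNzRingType) N (f : 'I_N -> fps A) M n :
  (n < M)%N -> (\prod_(i < N) fps_trunc M (f i))`_n =
               (\big[@fps_mul A/fps_one A]_(i < N) f i) n.
Proof.
elim/big_rec2: _ n => [n _|i g p _ IHi n ltnM]; first by rewrite coef1.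
by rewrite mulrC (coef_mul_trunc IHi) // fps_mulC.
Qed.

Lemma rmorph_fps_prod (A B : comNzRingType) (phi : {rmorphism A -> B}) N
    (f : 'I_N -> fps A) n :
  phi ((\big[@fps_mul A/fps_one A]_(i < N) f i) n) =
  (\big[@fps_mul B/fps_one B]_(i < N) (fun m => phi (f i m))) n.
Proof.
elim/big_rec2: _ n => [n|i g h _ IHi n]; first by rewrite /fps_one rmorph_nat.
rewrite rmorph_sum; apply: eq_bigr => j _.
by rewrite rmorphM IHi.
Qed.

Section RFun.
Variable K : fieldType.
Implicit Types (a b : fps K).

(** Choosing an exponent in each factor F(x_i t) selects one monomial. Symmetry, homogeneity and
    stability of R_n, as well as h_n and e_n as special cases, are read off from this formula. *)
Lemma mcoeff_Rfun a n N (m : 'X_{1..N}) :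
  (Rfun a n N)@_m = if mdeg m == n then \prod_i a (m i) else 0.
Proof.
rewrite /Rfun -(@coef_trunc_prod _ _ _ n.+1) //.
rewrite (eq_bigr _ (fun i _ => poly_def n.+1 _)) bigA_distr_bigA coef_sum raddf_sum /=.
pose mg (g : {ffun 'I_N -> 'I_n.+1}) := [multinom g i : nat | i < N].
have termE (g : {ffun 'I_N -> 'I_n.+1}) :
    ((\prod_i (fps_dil 'X_i (fun k => (a k)%:MP) (g i)
        *: 'X^(g i : nat) : {poly {mpoly K[N]}}))`_n)@_m =
    (\prod_i a (g i)) *+ (mg g == m) *+ (mdeg (mg g) == n).
  rewrite scaler_prod -expr_sum coefZ coefXn /fps_dil big_split /=.
  have -> : \prod_i 'X_i ^+ g i = 'X_[mg g] :> {mpoly K[N]}.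
    by rewrite [RHS]mpolyXE_id; apply: eq_bigr => i _; rewrite mnmE.
  rewrite -rmorph_prod mulrC mulr_natl mcoeffMn mulrC mcoeffCM mcoeffX mulr_natr.
  by rewrite mdegE [n == _]eq_sym (eq_bigr _ (fun i _ => mnmE _ i)).
rewrite (eq_bigr _ (fun g _ => termE g)).
case: eqP => [degm|/eqP degm]; last first.
  rewrite big1 // => g _; case: (mg g =P m) => [-> | _]; last by rewrite mulr0n mul0rn.
  by rewrite (negPf degm).
have lem i : (m i <= n)%N by rewrite -degm mdegE (bigD1 i) //= leq_addr.
pose g0 : {ffun 'I_N -> 'I_n.+1} := [ffun i => inord (m i)].
have g0E : mg g0 = m by apply/mnmP=> i; rewrite mnmE ffunE inordK ?ltnS.
rewrite (bigD1 g0) //= g0E eqxx degm eqxx !mulr1n [X in _ + X]big1 ?addr0 => [|g neq].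
  by apply: eq_bigr => i _; rewrite ffunE inordK ?ltnS.
case: (mg g =P m) => [mE|_]; last by rewrite mulr0n mul0rn.
case/eqP: neq; apply/ffunP=> i; apply: val_inj; rewrite ffunE /= inordK ?ltnS //.
by rewrite -mE mnmE.
Qed.

Lemma hsymE k N : hsym K k N = Rfun (fun=> 1) k N.
Proof.
apply/mpolyP=> m; rewrite mcoeff_Rfun big1_eq /hsym raddf_sum /=.
case: eqP => [degm|/eqP degm]; last first.
  rewrite big1 // => m' /eqP degm'; rewrite mcoeffX; case: eqP => // mE.
  by rewrite -mE degm' eqxx in degm.
have ltm : (mdeg m < k.+1)%N by rewrite degm.
rewrite (bigD1 (BMultinom ltm)) /= ?degm // mcoeffX eqxx big1 ?addr0 // => m'.
by case/andP=> _ neq; rewrite mcoeffX; case: eqP => // mE; case/eqP: neq; apply: val_inj.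
Qed.

Lemma mesymE_Rfun k N : mesym N K k = Rfun (fun m => (m <= 1)%:R) k N.
Proof.
apply/mpolyP=> m; rewrite mcoeff_mesym mcoeff_Rfun /mechar; case: eqP => //= _.
case: (boolP [forall i, (m i <= 1)%N]) => [/forallP lem|].
  by rewrite big1 // => i _; rewrite lem.
by rewrite negb_forall => /existsP[i lei]; rewrite (bigD1 i) //= (negPf lei) mul0r.
Qed.

Definition psym k N : {mpoly K[N]} := \sum_(i < N) 'X_i ^+ k.

Lemma fps_logder_Rfun a b N : fps_logder a b ->
  fps_logder (fun n => Rfun a n N) (fun k => b k *: psym k N).
Proof.
move=> ab; have -> : (fun k => b k *: psym k N) =
    \big[@fps_add {mpoly K[N]}/fun=> 0]_(i < N) fps_dil 'X_i (fun m => (b m)%:MP).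
  apply: functional_extensionality => k.
  transitivity (\sum_(i < N) fps_dil 'X_i (fun m => (b m)%:MP) k : {mpoly K[N]}).
    rewrite /psym scaler_sumr; apply: eq_bigr => i _.
    by rewrite /fps_dil mulrC mul_mpolyC.
  by elim/big_rec2: _ => // i x y _ ->.
rewrite /Rfun; elim/big_rec2: _ => [|i f g _ IHi]; first exact: fps_logder_one.
apply: fps_logderM IHi; apply: fps_logder_dil => n.
rewrite -mpolyC_nat -mpolyCM ab /fps_mul rmorph_sum /=.
by apply: eq_bigr => j _; rewrite mpolyCM.
Qed.

Lemma Rfun0 a N : a 0%N = 1 -> Rfun a 0 N = 1.
Proof.
move=> a0; apply/mpolyP=> m.
rewrite mcoeff_Rfun mcoeff1 mdeg_eq0; case: eqP => // ->.
by rewrite big1 // => i _; rewrite mnmE.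
Qed.

Lemma RfunE a b n N : a 0%N = 1 -> fps_logder a b ->
  n%:R * Rfun a n N = \sum_(k < n) b k.+1 *: psym k.+1 N * Rfun a (n - k.+1) N.
Proof. by move=> a0 /fps_logder_Rfun/fps_logderE-> //; apply: Rfun0. Qed.

Definition mnm_ext N (m : 'X_{1..N}) : 'X_{1..N.+1} :=
  [multinom oapp m 0%N (unlift ord_max i) | i < N.+1].

Lemma mcoeff_drop_last_var N (p : {mpoly K[N.+1]}) m :
  (drop_last_var p)@_m = p@_(mnm_ext m).
Proof.
rewrite {2}[p]mpolyE /drop_last_var comp_mpolyEX !raddf_sum; apply: eq_bigr => m' _.
rewrite /= !mcoeffZ mcoeffX comp_mpolyX; congr (_ * _).
rewrite (bigD1_ord ord_max) //= tnth_mktuple unlift_none /=.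
under eq_bigr do rewrite tnth_mktuple liftK /=.
rewrite (_ : \prod_(i < N) _ = 'X_[[multinom m' (lift ord_max i) | i < N]]); last first.
  by rewrite [RHS]mpolyXE_id; apply: eq_bigr => i _; rewrite mnmE.
case: (posnP (m' ord_max)) => [m'0|m'gt0]; last first.
  rewrite expr0n (negPf (lt0n_neq0 m'gt0)) mul0r mcoeff0; case: eqP => // m'E.
  by move: m'gt0; rewrite m'E mnmE unlift_none.
rewrite m'0 expr0 mul1r mcoeffX; congr (_ : bool)%:R; apply/eqP/eqP => [<-|->].
  apply/mnmP=> i; rewrite mnmE; case: unliftP => [j ->|->] /=; first by rewrite mnmE.
  exact: m'0.
by apply/mnmP=> i; rewrite !mnmE liftK.
Qed.

Lemma homog_symfun_Rfun a n : a 0%N = 1 -> homog_symfun n (Rfun a n).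
Proof.
move=> a0; split=> N.
- apply/issymP=> s; apply/mpolyP=> m; rewrite mcoeff_sym !mcoeff_Rfun mdeg_mperm.
  case: eqP => // _; rewrite [RHS](reindex_inj (@perm_inj _ s)).
  by apply: eq_bigr => i _; rewrite mnmE.
- apply/dhomogP=> m; rewrite mcoeff_msupp mcoeff_Rfun.
  by case: (mdeg m =P n) => [degm _ //|_]; rewrite eqxx.
apply/mpolyP=> m; rewrite mcoeff_drop_last_var !mcoeff_Rfun.
have mext_lift j : mnm_ext m (lift ord_max j) = m j by rewrite mnmE liftK.
have mext_max : mnm_ext m ord_max = 0%N by rewrite mnmE unlift_none.
rewrite !mdegE !(bigD1_ord ord_max) //= mext_max a0 mul1r add0n.
by rewrite (eq_bigr _ (fun j _ => mext_lift j)); under [in X in if _ then X else _]eq_bigr do rewrite mext_lift.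
Qed.

Lemma eval_ones_Rfun a k n : eval_ones k (Rfun a n) = fps_pow a k n.
Proof.
rewrite /eval_ones /Rfun rmorph_fps_prod /=.
rewrite (eq_bigr (fun=> a)) => [|i _]; last first.
  apply: functional_extensionality => m.
  by rewrite rmorphM rmorphXn /= mevalXU mevalC expr1n mul1r.
by rewrite big_const_ord.
Qed.

Lemma homog_symfunB n f g : homog_symfun n f -> homog_symfun n g ->
  @homog_symfun K n (fun N => f N - g N).
Proof.
move=> [f1 f2 f3] [g1 g2 g3]; split=> N.
- by apply: rpredB; [exact: f1|exact: g1].
- by apply: rpredB; [exact: f2|exact: g2].
by rewrite -(f3 N) -(g3 N) /drop_last_var raddfB.
Qed.

Lemma homog_symfunZ n c f : homog_symfun n f -> @homog_symfun K n (fun N => c *: f N).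
Proof.
move=> [f1 f2 f3]; split=> N.
- by apply: rpredZ; exact: f1.
- by apply: rpredZ; exact: f2.
by rewrite -(f3 N) /drop_last_var linearZ.
Qed.

Lemma homog_symfun_sum n (I : eqType) (r : seq I) (F : I -> varfam K) :
  {in r, forall i, homog_symfun n (F i)} -> homog_symfun n (fun N => \sum_(i <- r) F i N).
Proof.
move=> homF; split=> N.
- by rewrite big_seq; apply: rpred_sum => i /homF[symF _ _]; exact: symF.
- by rewrite big_seq; apply: rpred_sum => i /homF[_ degF _]; exact: degF.
rewrite /drop_last_var raddf_sum /= big_seq [RHS]big_seq; apply: eq_bigr => i /homF[_ _ dropF].
exact: dropF.
Qed.

Lemma homog_symfunM m n f g : homog_symfun m f -> homog_symfun n g ->
  @homog_symfun K (m + n) (fun N => f N * g N).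
Proof.
move=> [f1 f2 f3] [g1 g2 g3]; split=> N.
- by apply: rpredM; [exact: f1|exact: g1].
- by apply: dhomogM; [exact: f2|exact: g2].
by rewrite -(f3 N) -(g3 N) /drop_last_var rmorphM.
Qed.

Lemma homog_symfun1 : @homog_symfun K 0 (fun N => 1).
Proof.
split=> N; [exact: rpred1|exact: dhomog1|].
by rewrite /drop_last_var rmorph1.
Qed.

(* A monomial of degree n in N > n variables misses a variable, which symmetry
   allows to be the last one. *)
Lemma homog_symfun_eq0 n (f : varfam K) :
  homog_symfun n f -> f n = 0 -> forall N, f N = 0.
Proof.
move=> [symf homf dropf] fn0 N.
case: (leqP N n) => [leNn|/ltnW].
  rewrite -(subKn leNn).
  elim: (n - N)%N (leq_subr N n) => [|d IHd] led; first by rewrite subn0.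
  rewrite -dropf; have := IHd (ltnW led); rewrite -subnSK // => ->.
  by rewrite /drop_last_var raddf0.
move/subnKC=> <-; elim: (N - n)%N => [|d IHd]; first by rewrite addn0.
rewrite addnS; apply/mpolyP=> m; rewrite mcoeff0.
have [degm|degm] := eqVneq (mdeg m) n; last exact: dhomog_nemf_coeff degm.
have [i /eqP mi0] : exists i, m i == 0%N.
  apply/existsP; apply: contraT; rewrite negb_exists => /forallP mgt0.
  have: ((n + d).+1 <= mdeg m)%N.
    rewrite mdegE -[X in (X <= _)%N]card_ord -sum1_card leq_sum // => j _.
    by rewrite lt0n.
  by rewrite degm ltnNge leq_addr.
pose s := tperm i ord_max.
rewrite -(msym_coeff m s (symf _)).
set m' := [multinom _ | _ < _].
have m'max : m' ord_max = 0%N by rewrite mnmE tpermR.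
have -> : m' = mnm_ext [multinom m' (lift ord_max j) | j < n + d].
  apply/mnmP=> j; rewrite [RHS]mnmE; case: unliftP => [k ->|->] /=; last by [].
  by rewrite mnmE.
by rewrite -mcoeff_drop_last_var dropf IHd mcoeff0.
Qed.

Lemma homog_symfun_eq n (f g : varfam K) :
  homog_symfun n f -> homog_symfun n g -> f n = g n -> forall N, f N = g N.
Proof.
move=> homf homg fgn N; apply/eqP; rewrite -subr_eq0; apply/eqP.
by apply: (homog_symfun_eq0 (homog_symfunB homf homg)); rewrite fgn subrr.
Qed.

End RFun.

(** * Expansions in complete homogeneous symmetric functions *)

Section HBasis.
Variable K : fieldType.
Hypothesis charK0 : [pchar K] =i pred0.

Lemma fps_logder_ones (A : comNzRingType) :
  fps_logder (fun=> 1 : A) (fun k => (k != 0%N)%:R).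
Proof.
move=> n; rewrite mulr1 /fps_mul big_ord_recl mul0r add0r.
rewrite (eq_bigr (fun=> 1)) => [|i _]; last by rewrite mulr1.
by rewrite sumr_const card_ord.
Qed.

Lemma fps_logder_1D (A : comNzRingType) :
  fps_logder (fun m => (m <= 1)%:R : A) (fun k => if k is k'.+1 then (-1) ^+ k' else 0).
Proof.
case=> [|[|n]]; rewrite /fps_mul.
- by rewrite big_ord1 /= mulr0n !mul0r.
- by rewrite !big_ord_recl big_ord0 /= mul0r addr0 add0r.
rewrite mulr0 2!big_ord_recr big1 => [|i _] /=; last first.
  rewrite leqNgt (_ : (1 < n.+2 - i)%N) ?mulr0 //.
  by rewrite ltn_subRL addn1 ltnS ltn_ord.
by rewrite subnn subSnn !mulr1 /= add0r exprS mulN1r addrN.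
Qed.

Lemma hsym_logder N : fps_logder (fun n => hsym K n N) (fun k => (k != 0%N)%:R *: psym K k N).
Proof.
have := fps_logder_Rfun N (fps_logder_ones K).
by congr fps_logder; apply: functional_extensionality => n; rewrite hsymE.
Qed.

Lemma mesym_logder N : fps_logder (fun n => mesym N K n)
  (fun k => (if k is k'.+1 then (-1) ^+ k' else 0) *: psym K k N).
Proof.
have := fps_logder_Rfun N (fps_logder_1D K).
by congr fps_logder; apply: functional_extensionality => n; rewrite mesymE_Rfun.
Qed.

Lemma hsym0 N : hsym K 0 N = 1.
Proof. by rewrite hsymE Rfun0. Qed.

Section Span.
Variable N : nat.
Implicit Types p q : {mpoly K[N]}.

(** Only existence is recorded: for N < n the h_l are dependent in [N] variables, and the
    coefficients may depend on [N]. *)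
Definition hspan n p := exists c, p = \sum_(l <- partns n) c l *: hfun K l N.

Lemma hspan0 n : hspan n 0.
Proof. by exists (fun=> 0); rewrite big1 // => l _; rewrite scale0r. Qed.

Lemma hspanD n p q : hspan n p -> hspan n q -> hspan n (p + q).
Proof.
move=> [c ->] [d ->]; exists (fun l => c l + d l).
by rewrite -big_split; apply: eq_bigr => l _; rewrite scalerDl.
Qed.

Lemma hspanZ n x p : hspan n p -> hspan n (x *: p).
Proof.
move=> [c ->]; exists (fun l => x * c l).
by rewrite scaler_sumr; apply: eq_bigr => l _; rewrite scalerA.
Qed.

Lemma hspanB n p q : hspan n p -> hspan n q -> hspan n (p - q).
Proof. by move=> hp hq; apply: hspanD => //; rewrite -scaleN1r; apply: hspanZ. Qed.

Lemma hspan_sum n (I : eqType) (r : seq I) (P : pred I) (F : I -> {mpoly K[N]}) :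
  (forall i, i \in r -> P i -> hspan n (F i)) -> hspan n (\sum_(i <- r | P i) F i).
Proof.
move=> hF; rewrite big_seq_cond; elim/big_rec: _ => [|i p /andP[ri Pi]].
  exact: hspan0.
by apply: hspanD; apply: hF.
Qed.

Lemma hspan_hfun n l : is_partn n l -> hspan n (hfun K l N).
Proof.
rewrite -mem_partns => ln; exists (fun l' => (l' == l)%:R).
rewrite (bigD1_seq l) ?partns_uniq //= eqxx scale1r big1 ?addr0 // => l' /negPf->.
by rewrite scale0r.
Qed.

Lemma is_partn_sort m n l l' : is_partn m l -> is_partn n l' ->
  is_partn (m + n) (sort geq (l ++ l')).
Proof.
move=> /and3P[_ l0 /eqP suml] /and3P[_ l0' /eqP suml']; apply/and3P; split.
- by apply: sort_sorted => x y; apply: leq_total.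
- by rewrite mem_sort mem_cat negb_or l0.
by rewrite (perm_sumn (permEl (perm_sort _ _))) sumn_cat suml suml'.
Qed.

Lemma hspanM m n p q : hspan m p -> hspan n q -> hspan (m + n) (p * q).
Proof.
move=> [c ->] [d ->]; rewrite mulr_suml; apply: hspan_sum => l ln _.
rewrite mulr_sumr; apply: hspan_sum => l' ln' _.
rewrite -scalerAl -scalerAr; do 2!apply: hspanZ.
rewrite !mem_partns in ln ln'.
have -> : hfun K l N * hfun K l' N = hfun K (sort geq (l ++ l')) N.
  by rewrite /hfun (perm_big _ (permEl (perm_sort _ _))) big_cat.
exact/hspan_hfun/is_partn_sort.
Qed.

Lemma hspan1 : hspan 0 1.
Proof.
have -> : 1 = hfun K [::] N by rewrite /hfun big_nil.
exact: hspan_hfun.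
Qed.

Lemma hspan_hsym n : hspan n (hsym K n N).
Proof.
case: n => [|n]; first by rewrite hsym0; apply: hspan1.
have -> : hsym K n.+1 N = hfun K [:: n.+1] N by rewrite /hfun big_seq1.
by apply: hspan_hfun; rewrite /is_partn /= addn0 eqxx.
Qed.

(** The recursion for h_n contains p_n only in the term p_n h_0, hence can be solved for p_n without
    division. *)
Lemma hspan_psym n : (0 < n)%N -> hspan n (psym K n N).
Proof.
elim/ltn_ind: n => -[//|n] IHn _.
have := fps_logderE n.+1 (@hsym_logder N) (hsym0 N).
rewrite big_ord_recr /= subnn hsym0 mulr1 scale1r => /eqP.
rewrite addrC -subr_eq => /eqP <-; apply: hspanB.
  by rewrite mulr_natl -scaler_nat; apply/hspanZ/hspan_hsym.
apply: hspan_sum => k _ _; rewrite -scalerAl; apply: hspanZ.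
have lt_kn : (k.+1 < n.+1)%N by rewrite ltnS ltn_ord.
rewrite -{1}(subnKC (ltnW lt_kn)); apply: hspanM; last exact: hspan_hsym.
exact: IHn.
Qed.

(** The recursion yields n e_n in terms of power sums and smaller e_k; characteristic 0 allows
    division by n. *)
Lemma hspan_mesym n : hspan n (mesym N K n).
Proof.
elim/ltn_ind: n => -[|n] IHn; first by rewrite mesym0E; apply: hspan1.
have := fps_logderE n.+1 (@mesym_logder N) (mesym0E _ _) => eqn.
have -> : mesym N K n.+1 = (n.+1%:R)^-1 *: (n.+1%:R * mesym N K n.+1).
  by rewrite mulr_natl -scaler_nat scalerA mulVf ?scale1r ?natS_neq0.
rewrite eqn; apply/hspanZ/hspan_sum => k _ _; rewrite -scalerAl; apply: hspanZ.
have le_kn : (k.+1 <= n.+1)%N by rewrite ltn_ord.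
rewrite -{1}(subnKC le_kn); apply: hspanM; first exact: hspan_psym.
by apply: IHn; rewrite ltn_subrL.
Qed.

Lemma hspan_symmetric n p : p \is symmetric -> p \is n.-homog -> hspan n p.
Proof.
move=> symp homp; have [t [<- homt]] := sym_fundamental_homog symp homp.
rewrite comp_mpolyEX; apply: hspan_sum => m mt _; apply: hspanZ.
rewrite -(dhomog_mf homt mt) comp_mpolyX.
have -> : \prod_(i < N) tnth [tuple mesym N K i.+1 | i < N] i ^+ m i =
          \prod_(i < N) mesym N K i.+1 ^+ m i.
  by apply: eq_bigr => i _; rewrite tnth_mktuple.
(* The weight of a monomial in the e's counts variable [i] as i + 1, the degree of e_(i+1); these
   degrees add up under [hspanM]. *)
rewrite -[_ m]/(\sum_(i < N) m i * i.+1)%N.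
apply: (big_ind2 hspan) => [|? ? ? ?|i _]; [exact: hspan1|exact: hspanM|].
elim: (m i) => [|d IHd]; first by rewrite mul0n expr0; exact: hspan1.
by rewrite exprS mulSn; apply: hspanM => //; apply: hspan_mesym.
Qed.

End Span.

Lemma homog_symfun_hsym n : homog_symfun n (hsym K n).
Proof.
have [f1 f2 f3] := @homog_symfun_Rfun K (fun=> 1) n erefl.
split=> N; rewrite !hsymE; [exact: f1|exact: f2|exact: f3].
Qed.

Lemma homog_symfun_hfun l : homog_symfun (sumn l) (hfun K l).
Proof.
elim: l => [|k l IHl]; first have [f1 f2 f3] := homog_symfun1 K.
  by split=> N; rewrite /hfun !big_nil; [exact: f1|exact: f2|exact: f3].
have [f1 f2 f3] := homog_symfunM (homog_symfun_hsym k) IHl.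
by split=> N; rewrite /hfun !big_cons; [exact: f1|exact: f2|exact: f3].
Qed.

Lemma homog_symfun_hsum n c :
  homog_symfun n (fun N => \sum_(l <- partns n) c l *: hfun K l N).
Proof.
apply: (homog_symfun_sum (F := fun l N => c l *: hfun K l N)) => l.
rewrite mem_partns => /and3P[_ _ /eqP <-].
exact/homog_symfunZ/homog_symfun_hfun.
Qed.

(** The coefficients found in [n] variables serve for every number of variables, since a stable
    family of degree [n] is determined by its member in [n] variables. *)
Lemma hfun_expansion n f : homog_symfun n f -> exists c, is_expansion (@hfun K) n f c.
Proof.
move=> homf; have [symf degf _] := homf.
have [c fn] := hspan_symmetric (symf n) (degf n).
exists c; exact: homog_symfun_eq homf (homog_symfun_hsum _ _) fn.
Qed.

End HBasis.

(** * Specializations of symmetric polynomials *)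

Section Specialization.
Variable K : fieldType.
Hypothesis charK0 : [pchar K] =i pred0.

(** The laws are required on symmetric arguments only: the maps built below go through [symf], which
    expresses a symmetric polynomial in the e_k and is meaningful only there. *)
Definition sym_hom N (Psi : {mpoly K[N]} -> {poly K}) : Prop :=
  [/\ Psi 1 = 1, {in symmetric &, {morph Psi : p q / p + q}},
      {in symmetric &, {morph Psi : p q / p * q}}
    & forall c, {in symmetric, {morph Psi : p / c *: p}}].

Lemma psym_sym k N : psym K k N \is symmetric.
Proof.
apply/issymP=> s; rewrite /psym [LHS]rmorph_sum /= [RHS](reindex_inj (@perm_inj _ s)).
by apply: eq_bigr => i _; rewrite rmorphXn /= /msym mmapX mmap1U.
Qed.

Lemma Rfun_sym (a : fps K) n N : a 0%N = 1 -> Rfun a n N \is symmetric.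
Proof. by move=> a0; have [symR _ _] := homog_symfun_Rfun n a0; apply: symR. Qed.

Lemma sym_hom_sum N Psi (I : eqType) (r : seq I) (F : I -> {mpoly K[N]}) :
  sym_hom Psi -> {in r, forall i, F i \is symmetric} ->
  Psi (\sum_(i <- r) F i) = \sum_(i <- r) Psi (F i).
Proof.
move=> [_ PsiD _ PsiZ] symF; elim: r symF => [_|i r IHr symF].
  by rewrite !big_nil -(scale0r (0 : {mpoly K[N]})) PsiZ ?scale0r ?rpred0.
have symr : {in r, forall i, F i \is symmetric}.
  by move=> j rj; apply: symF; rewrite inE rj orbT.
rewrite !big_cons PsiD ?IHr //; first by rewrite symF ?mem_head.
by rewrite big_seq; apply: rpred_sum.
Qed.

Lemma sym_hom_Rfun N Psi (a b : fps K) n :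
    @sym_hom N Psi -> a 0%N = 1 -> fps_logder a b ->
  n%:R * Psi (Rfun a n N) =
  \sum_(k < n) b k.+1 *: Psi (psym K k.+1 N) * Psi (Rfun a (n - k.+1) N).
Proof.
move=> homPsi a0 ab; have [_ _ PsiM PsiZ] := homPsi.
have := RfunE n N a0 ab; rewrite mulr_natl -scaler_nat => /(congr1 Psi).
rewrite PsiZ ?Rfun_sym // scaler_nat mulr_natl => ->.
rewrite (sym_hom_sum homPsi) => [|k _]; last first.
  by apply: rpredM; [apply: rpredZ; apply: psym_sym|apply: Rfun_sym].
by apply: eq_bigr => k _; rewrite PsiM ?PsiZ ?rpredZ ?psym_sym ?Rfun_sym.
Qed.

(** As b_k does not vanish, the recursion for R_k can be solved for p_k. It is applied to F = 1 + t,
    where b_k is a sign, to pass from values on the e_k to values on the p_k. *)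
Lemma sym_hom_psym N Psi (a b : fps K) (f pi : fps {poly K}) :
    @sym_hom N Psi -> a 0%N = 1 -> fps_logder a b ->
    (forall k, (0 < k)%N -> b k != 0) ->
    (forall k, (k <= N)%N -> Psi (Rfun a k N) = f k) ->
    fps_logder f (fun k => b k *: pi k) -> f 0%N = 1 ->
  forall k, (0 < k <= N)%N -> Psi (psym K k N) = pi k.
Proof.
move=> homPsi a0 ab b0 Psif fpi f0; elim/ltn_ind => -[//|k] IHk /andP[_ lekN].
have := sym_hom_Rfun k.+1 homPsi a0 ab.
rewrite Psif // (fps_logderE _ fpi) // !big_ord_recr /= subnn f0 Psif // f0 !mulr1.
rewrite (eq_bigr (fun i : 'I_k => b i.+1 *: Psi (psym K i.+1 N)
           * Psi (Rfun a (k.+1 - i.+1) N))) => [|i _]; last first.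
  rewrite IHk ?ltnS // ?Psif // ?(leq_trans _ lekN) ?leq_subr //.
  by rewrite ltnS ltnW.
move/addrI => eqb; apply: (scalerI (b0 k.+1 isT)); exact: esym eqb.
Qed.

(** The converse passage, from the p_k to the R_k: here the recursion is divided by k. With F = 1/(1
    - t) it gives the values on the h_k. *)
Lemma sym_hom_Rfun_eq N Psi (a b : fps K) (f pi : fps {poly K}) :
    @sym_hom N Psi -> a 0%N = 1 -> fps_logder a b ->
    (forall k, (0 < k <= N)%N -> Psi (psym K k N) = pi k) ->
    fps_logder f (fun k => b k *: pi k) -> f 0%N = 1 ->
  forall k, (k <= N)%N -> Psi (Rfun a k N) = f k.
Proof.
move=> homPsi a0 ab Psip fpi f0; have [Psi1 _ _ _] := homPsi.
elim/ltn_ind => -[|k] IHk lekN; first by rewrite Rfun0 // Psi1 f0.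
have := sym_hom_Rfun k.+1 homPsi a0 ab.
rewrite (eq_bigr (fun i : 'I_k.+1 => b i.+1 *: pi i.+1 * f (k.+1 - i.+1)%N)); last first.
  move=> i _; rewrite Psip ?IHk ?ltn_subrL ?(leq_trans (leq_subr _ _)) //=.
  exact: leq_trans (ltn_ord i) lekN.
rewrite -(fps_logderE _ fpi f0) !mulr_natl -!scaler_nat.
exact/scalerI/natS_neq0.
Qed.

(** The map is evaluation of the e_k at the coefficients of 1/eta(-t). Its values on the h_k follow
    by going from the e_k to the p_k and from there to the h_k. *)
Lemma sym_hom_exists N (eta pi : fps {poly K}) :
  eta 0%N = 1 -> fps_logder eta pi ->
  exists2 Psi, @sym_hom N Psi &
    (forall k, (k <= N)%N -> Psi (hsym K k N) = eta k) /\
    (forall k, (0 < k <= N)%N -> Psi (psym K k N) = pi k).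
Proof.
move=> eta0 etapi; pose eps := fps_inv (fps_dil (-1) eta).
have dil0 : fps_dil (-1) eta 0%N = 1 by rewrite /fps_dil expr0 mul1r.
have eps0 : eps 0%N = 1.
  by have /(congr1 (fun g => g 0%N)) := fps_mulV dil0; rewrite /fps_mul big_ord1 dil0 mul1r.
have pi0 : pi 0%N = 0.
  by have := etapi 0%N; rewrite mul0r /fps_mul big_ord1 eta0 mulr1.
(* Replacing t by -t and inverting multiplies the k-th coefficient of the logarithmic derivative by
   -(-1)^k, the sign in the recursion for e_n. *)
have epspi : fps_logder eps
    (fun k => (if k is k'.+1 then (-1) ^+ k' else 0) *: pi k).
  have := fps_logder_inv dil0 (fps_logder_dil (-1) etapi).
  congr fps_logder; apply: functional_extensionality => -[|k]; rewrite /fps_opp /fps_dil.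
    by rewrite pi0 mulr0 oppr0 scaler0.
  by rewrite exprS mulN1r mulNr opprK -mul_polyC rmorphXn rmorphN rmorph1.
pose ev := mmap (@polyC K) (fun i : 'I_N => eps i.+1).
have evM : {morph ev : p q / p * q} by move=> p q; rewrite /ev rmorphM.
pose S := [tuple mesym N K i.+1 | i < N].
pose Psi p := ev (symf p).
have PsiE t : t \mPo S \is symmetric -> Psi (t \mPo S) = ev t.
  by move=> symt; rewrite /Psi; congr ev; apply: msym_fundamental_un; rewrite -symfP.
have homPsi : sym_hom Psi.
  split=> [|p q symp symq|p q symp symq|c p symp].
  - by rewrite -[1 in LHS](rmorph1 (comp_mpoly S)) PsiE ?rmorph1 ?rpred1 // /ev rmorph1.
  - rewrite {1}(symfP symp) {1}(symfP symq) -comp_mpolyD PsiE; first exact: mmapD.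
    by rewrite comp_mpolyD -!symfP // rpredD.
  - rewrite {1}(symfP symp) {1}(symfP symq) -rmorphM PsiE; first exact: evM.
    by rewrite rmorphM /= -!symfP // rpredM.
  rewrite {1}(symfP symp) -comp_mpolyZ PsiE; first by rewrite /ev mmapZ mul_polyC.
  by rewrite comp_mpolyZ -symfP // rpredZ.
have Psie k : (k <= N)%N -> Psi (Rfun (fun m => (m <= 1)%:R) k N) = eps k.
  case: k => [_|k ltkN]; first by rewrite Rfun0 //; have [->] := homPsi.
  rewrite -mesymE_Rfun.
  have XS : 'X_(Ordinal ltkN) \mPo S = mesym N K k.+1.
    by rewrite comp_mpolyXU -tnth_nth tnth_mktuple.
  by rewrite -XS PsiE ?XS ?mesym_sym // /ev mmapX mmap1U.
have Psip : forall k, (0 < k <= N)%N -> Psi (psym K k N) = pi k.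
  apply: (sym_hom_psym homPsi _ (@fps_logder_1D K) _ Psie epspi) => // -[//|k] _.
  by rewrite signr_eq0.
exists Psi => //; split=> // k lekN; rewrite hsymE.
apply: (sym_hom_Rfun_eq homPsi _ (@fps_logder_ones K) Psip) => //.
have := etapi; congr fps_logder; apply: functional_extensionality => -[|j].
  by rewrite pi0 scaler0.
by rewrite scale1r.
Qed.

(* Specializing h_k to eta_k for all k turns an h-expansion of R_n into a linear
   relation between its coefficients. *)
Lemma Rfun_specialization (a b : fps K) (eta pi : fps {poly K}) n :
    a 0%N = 1 -> fps_logder a b -> eta 0%N = 1 -> fps_logder eta pi ->
  exists r : fps {poly K}, [/\ r 0%N = 1,
    forall m, (m <= n)%N ->
      m%:R * r m = \sum_(k < m) b k.+1 *: pi k.+1 * r (m - k.+1)%N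
  & forall c, is_expansion (@hfun K) n (Rfun a n) c ->
      r n = \sum_(l <- partns n) c l *: \prod_(k <- l) eta k].
Proof.
move=> a0 ab eta0 etapi; have [Psi homPsi [Psih Psip]] := sym_hom_exists n eta0 etapi.
have [Psi1 _ PsiM PsiZ] := homPsi.
exists (fun m => Psi (Rfun a m n)); split=> [|m lemn|c expc].
- by rewrite Rfun0.
- rewrite (sym_hom_Rfun m homPsi a0 ab); apply: eq_bigr => k _; rewrite Psip //=.
  exact: leq_trans (ltn_ord k) lemn.
have symh l : hfun K l n \is symmetric by have [symh _ _] := homog_symfun_hfun K l; apply: symh.
rewrite expc (sym_hom_sum homPsi) => [|l _]; last by apply: rpredZ.
rewrite big_seq [RHS]big_seq; apply: eq_bigr => l; rewrite mem_partns => /and3P[_ _ /eqP suml].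
rewrite PsiZ //; congr (_ *: _).
(* Weakened to an inequality for the induction; each part is then at most [n], the number of
   variables, as [Psih] requires. *)
have: (sumn l <= n)%N by rewrite suml.
elim: l {suml} => [|k l IHl] /= lel; first by rewrite /hfun !big_nil.
have symk : hsym K k n \is symmetric by have [symk _ _] := homog_symfun_hsym K k; apply: symk.
rewrite /hfun !big_cons PsiM // -/(hfun K l n) ?IHl ?Psih //.
  exact: leq_trans (leq_addr _ _) lel.
exact: leq_trans (leq_addl _ _) lel.
Qed.

End Specialization.

(** * Coefficients of R_n in the h-basis *)

Section HCoef.
Variable K : fieldType.
Hypothesis charK0 : [pchar K] =i pred0.
Variables (a b : fps K).
Hypotheses (a0 : a 0%N = 1) (ab : fps_logder a b).

(** The index [j] stands for the number j + 1, whence the predecessor on the right. *)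
Lemma sum_multiples (A : zmodType) k n (F : nat -> A) :
    (0 < k)%N -> (forall j, ~~ (k %| j.+1)%N -> F j = 0) ->
  \sum_(j < k * n) F j = \sum_(i < n) F (k * i.+1).-1.
Proof.
case: k => // k _ F0; elim: n => [|n IHn]; first by rewrite muln0 !big_ord0.
rewrite [RHS]big_ord_recr -IHn mulnSr big_split_ord; congr (_ + _) => /=.
rewrite big_ord_recr big1 /= => [|i _]; first by rewrite add0r addnS.
by apply: F0; rewrite -addnS dvdn_addr ?dvdn_mulr // gtnNdvd // ltnS ltn_ord.
Qed.

Lemma coef_hfun_rect k n c : (0 < k)%N ->
    is_expansion (@hfun K) (k * n) (Rfun a (k * n)) c ->
  c (nseq n k) = fps_exp (fps_opp (fps_dil (-1) (fps_logser (fun i => b (k * i)%N)))) n.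
Proof.
move=> k0 expc; set g := fps_opp _; pose x := fps_exp g.
have g0 : g 0%N = 0 by rewrite /g /fps_opp /fps_dil /= mulr0 oppr0.
have x0 : x 0%N = 1 by rewrite /x /fps_exp /fps_comp big_ord1 /= invr1 mulr1.
have xE m : m%:R * x m = \sum_(i < m) (-1) ^+ i * b (k * i.+1)%N * x (m - i.+1)%N.
  rewrite (fps_logderE m (fps_logder_exp charK0 g0)) //; apply: eq_bigr => i _.
  rewrite /g /fps_opp /fps_dil /= exprS mulN1r mulNr opprK mulrCA [i.+1%:R * _]mulrC.
  by rewrite divfK ?natS_neq0.
pose eta m : {poly K} := ((m == 0%N) || (m == k))%:R.
(* The series of [eta] is 1 + t^k, with logarithmic derivative k t^k / (1 + t^k). *)
pose pi j : {poly K} :=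
  if (0 < j)%N && (k %| j)%N then k%:R * (-1) ^+ (j %/ k).-1 else 0.
have etapi : fps_logder eta pi.
  move=> m; rewrite fps_mulC /fps_mul big_ord_recl /= subn0 mul1r.
  rewrite (eq_bigr (fun i : 'I_m => if i == k.-1 :> nat then pi (m - k)%N else 0)); last first.
    move=> i _; rewrite /eta /bump /= add1n -{1}(prednK k0) eqSS.
    by case: eqP => [->|_]; rewrite ?mul0r // mul1r prednK.
  rewrite -big_mkcond (big_ord1_eq _ (fun=> pi (m - k)%N)) prednK //.
  rewrite /eta; case: (ltngtP m k) => [ltmk|ltkm|->].
  - rewrite addr0 orbF; case: m ltmk => [|m] ltmk; first by rewrite mul0r.
    by rewrite mulr0 /pi gtnNdvd.
  - rewrite orbF gtn_eqF ?(leq_ltn_trans _ ltkm) // mulr0 -{1}(subnK (ltnW ltkm)).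
    have: (0 < m - k)%N by rewrite subn_gt0.
    move: (m - k)%N => d d0; rewrite /pi d0 addn_gt0 d0 /= dvdn_addl //.
    case: ifP => [kd|_]; last by rewrite addr0.
    rewrite divnDr // divnn k0 addn1 /= -{1}(@prednK (d %/ k)).
      by rewrite exprS mulN1r mulrN addNr.
    by rewrite divn_gt0 // dvdn_leq.
  by rewrite orbT mulr1 subnn /pi k0 dvdnn divnn k0 expr0 mulr1 addr0.
have [r [r0 rE /(_ c expc) rc]] := Rfun_specialization charK0 (k * n) a0 ab erefl etapi.
(* As [pi] lives on multiples of k, so does the recursion. Its factor k cancels the one in k i,
   which leaves the recursion of [x]. *)
have rk i : (i <= n)%N -> r (k * i)%N = (x i)%:P.
  elim/ltn_ind: i => -[_ _|i IHi lein]; first by rewrite muln0 r0 x0.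
  have := rE (k * i.+1)%N; rewrite leq_pmul2l // => /(_ lein).
  rewrite (@sum_multiples _ k i.+1 (fun j => b j.+1 *: pi j.+1 * r (k * i.+1 - j.+1)%N)) //;
    last by move=> j /negPf kj; rewrite /pi kj scaler0 mul0r.
  rewrite (eq_bigr (fun j : 'I_i.+1 =>
      k%:R * ((-1) ^+ j * b (k * j.+1)%N * x (i.+1 - j.+1)%N)%:P)); last first.
    move=> j _; rewrite prednK ?muln_gt0 ?k0 // -mulnBr IHi ?ltn_subrL //; last first.
      exact: leq_trans (leq_subr _ _) lein.
    rewrite /pi muln_gt0 k0 dvdn_mulr //= mulKn //= -!mul_polyC !polyCM.
    by rewrite rmorphXn rmorphN rmorph1; ring.
  have kn0 : k%:R != 0 :> K by rewrite ((pcharf0P K).1 charK0) -lt0n.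
  rewrite -mulr_sumr -(rmorph_sum (@polyC K)) /= -xE polyCM polyC_natr natrM -mulrA.
  by rewrite !mulr_natl -!scaler_nat => /(scalerI kn0)/(scalerI (natS_neq0 charK0 _)).
have sort_nseq : sorted geq (nseq n k).
  by case: n {expc rE rc rk} => //= m; elim: m => //= m ->; rewrite andbT /geq /=.
have nseq_partn : nseq n k \in partns (k * n).
  rewrite mem_partns /is_partn sort_nseq sumn_nseq eqxx andbT mem_nseq.
  by rewrite (ltn_eqF k0) andbF.
have etaE l : l \in partns (k * n) -> \prod_(j <- l) eta j = (l == nseq n k)%:R.
  rewrite mem_partns => /and3P[_ l0 /eqP suml].
  case: (boolP (all (pred1 k) l)) => [/all_pred1P lE|].
    have szl : size l = n.
      by move: suml; rewrite {1}lE sumn_nseq => /eqP; rewrite eqn_pmul2l // => /eqP.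
    rewrite lE szl eqxx big_nseq /eta eqxx orbT.
    by elim: n {expc rE rc rk sort_nseq nseq_partn szl suml} => //= m ->; rewrite mulr1.
  case: eqP => [->|_]; first by rewrite all_nseq /= eqxx orbT.
  case/allPn => j lj /= /negPf jk; rewrite (big_rem j lj) /eta /= jk orbF.
  by case: eqP lj l0 => [-> ->|_ _ _] //; rewrite mul0r.
apply: (@polyC_inj K); rewrite -/x -rk // rc (bigD1_seq (nseq n k)) ?partns_uniq //=.
rewrite etaE // eqxx big_seq_cond big1 ?addr0 => [|l /andP[/etaE-> /negPf->]].
  by rewrite alg_polyC.
by rewrite scaler0.
Qed.

(** The series t f'/f. For products of two h's it is used without a closed form, through its
    coefficients at low powers of X. *)
Lemma fps_logder_exists (A : comNzRingType) (f : fps A) :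
  f 0%N = 1 -> exists c, fps_logder f c.
Proof.
move=> f0; pose th : fps A := fun n => n%:R * f n.
exists (fps_mul th (fps_inv f)) => n.
by rewrite -fps_mulA [fps_mul _ f]fps_mulC fps_mulV // fps_mulC fps_mul1.
Qed.

(** Each part contributes one factor X, so X^2 retains the partitions with two parts, both in {i,
    j}; of these only the one with parts i and j has sum n. The images of p_k and R_m matter only
    modulo X^3. *)
Lemma coef_hfun_two i j n c : (0 < i)%N -> (0 < j)%N -> (i + j)%N = n ->
    is_expansion (@hfun K) n (Rfun a n) c ->
  c [:: maxn i j; minn i j] =
  if i == j then (b i ^+ 2 - b n) / 2%:R else b i * b j - b n.
Proof.
move=> i0 j0 ijn expc; pose q m : K := ((m == i) || (m == j))%:R.
pose eta m : {poly K} := if m is 0 then 1 else q m *: 'X.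
have [pi etapi] := fps_logder_exists (erefl : eta 0%N = 1).
have [r [r0 rE /(_ c expc) rc]] := Rfun_specialization charK0 n a0 ab erefl etapi.
have etaS m : (0 < m)%N -> eta m = q m *: 'X by case: m.
have piS m : pi m.+1 = (m.+1%:R * q m.+1) *: 'X
                       - (\sum_(k < m) q (m - k)%N *: pi k.+1) * 'X.
  have := fps_logderE m.+1 etapi erefl; rewrite big_ord_recr /= subnn mulr1.
  rewrite mulr_natl -scaler_nat scalerA => ->; rewrite mulr_suml addrC -addrA -sumrB.
  rewrite big1 ?addr0 // => k _; rewrite subSS etaS ?subn_gt0 //.
  by rewrite -scalerAr -scalerAl subrr.
have pi0 m : (pi m.+1)`_0 = 0 by rewrite piS coefB coefZ coefX coefMX mulr0 subr0.
have pi1 m : (pi m.+1)`_1 = m.+1%:R * q m.+1.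
  rewrite piS coefB coefZ coefX coefMX /= coef_sum big1 ?mulr1 ?subr0 // => k _.
  by rewrite coefZ pi0 mulr0.
have pi2 m : (pi m.+1)`_2 = - \sum_(k < m) q (m - k)%N * (k.+1%:R * q k.+1).
  rewrite piS coefB coefZ coefX coefMX /= coef_sum mulr0 add0r; congr (- _).
  by apply: eq_bigr => k _; rewrite coefZ pi1.
have rS m s : (m < n)%N -> m.+1%:R * (r m.+1)`_s =
    \sum_(k < m) b k.+1 * (pi k.+1 * r (m - k)%N)`_s + b m.+1 * (pi m.+1)`_s.
  move=> ltmn; have /(congr1 (fun p : {poly K} => p`_s)) := rE m.+1 ltmn.
  rewrite mulr_natl coefMn => rs; rewrite mulr_natl rs big_ord_recr /= subnn r0 mulr1.
  rewrite coefD coefZ coef_sum; congr (_ + _); apply: eq_bigr => k _.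
  by rewrite subSS -scalerAl coefZ.
have r_0 m : (m < n)%N -> (r m.+1)`_0 = 0.
  move=> ltmn; apply: (mulfI (natS_neq0 charK0 m)); rewrite rS // pi0 !mulr0 addr0.
  by rewrite big1 // => k _; rewrite coef0M pi0 mul0r mulr0.
have r_0' m : (0 < m <= n)%N -> (r m)`_0 = 0 by case: m => // m; apply: r_0.
have r_1 m : (0 < m <= n)%N -> (r m)`_1 = b m * q m.
  case: m => // m /= ltmn; apply: (mulfI (natS_neq0 charK0 m)); rewrite rS // pi1.
  rewrite big1 ?add0r => [|k _]; first by rewrite mulrCA.
  rewrite coefM big_ord_recr big_ord1 /= pi0 mul0r add0r subnn r_0' ?mulr0 //.
  by have := ltn_ord k; lia.
(* The last factor is the sum of the elements of the set {i, j}: it is n if i and j differ, and i =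
   n/2 if they coincide, which is the origin of the 1/2. *)
have r_2 : n%:R * (r n)`_2 = (b i * b j - b n) * (n%:R - (i == j)%:R * i%:R).
  case: n ijn {expc rE rc} rS r_0 r_0' r_1 => [|n] ijn rS r_0 r_0' r_1; first by lia.
  rewrite rS // pi2 mulrN mulr_sumr -sumrB.
  transitivity (\sum_(k < n) (b i * b j - b n.+1) * (k.+1%:R * q k.+1)).
    apply: eq_bigr => k _; have ltkn := ltn_ord k.
    rewrite coefM !big_ord_recr big_ord0 /= pi0 mul0r !add0r subnn r_0' ?mulr0 ?addr0; last by lia.
    rewrite pi1 r_1; last by lia.
    case: (boolP ((k.+1 == i) || (k.+1 == j))) => kij; last first.
      have -> : q k.+1 = 0 by rewrite /q (negPf kij).
      by ring.
    have -> : q k.+1 = 1 by rewrite /q kij.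
    have -> : q (n - k)%N = 1 by rewrite /q (_ : _ || _) //; lia.
    suff <- : b k.+1 * b (n - k)%N = b i * b j by ring.
    by case/orP: kij => /eqP kE; [|rewrite mulrC]; congr (b _ * b _); lia.
  rewrite -mulr_sumr; congr (_ * _).
  have sumq s : (0 < s <= n)%N -> \sum_(k < n) k.+1%:R * (k.+1 == s)%:R = s%:R :> K.
    case: s => // s /= ltsn; rewrite (bigD1 (Ordinal ltsn)) //= eqxx mulr1 big1 ?addr0 //.
    by move=> k neq; rewrite eqSS (_ : (k == s :> nat) = false) ?mulr0 //; apply: negbTE.
  have sumi : (0 < i <= n)%N by lia.
  have sumj : (0 < j <= n)%N by lia.
  rewrite -ijn natrD -{1 2}(sumq i sumi) -{1}(sumq j sumj).
  rewrite mulr_sumr -big_split -sumrB; apply: eq_bigr => k _ /=.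
  rewrite /q; case: (i =P j) => [->|ij]; first by rewrite orbb /=; ring.
  by case: (k.+1 =P i) => [->|_]; case: (_ =P j) => //= *; ring.
have etaE l : l \in partns n ->
    (\prod_(k <- l) eta k)`_2 = (l == [:: maxn i j; minn i j])%:R.
  rewrite mem_partns => /and3P[sortl l0 /eqP suml].
  have -> : \prod_(k <- l) eta k = (\prod_(k <- l) q k) *: 'X^(size l).
    elim: l l0 {sortl suml} => [|k l IHl]; first by rewrite !big_nil scale1r.
    rewrite inE negb_or eq_sym -lt0n => /andP[k0 l0]; rewrite !big_cons IHl // etaS //.
    by rewrite -scalerAl -scalerAr scalerA exprS.
  rewrite coefZ coefXn; case: l sortl l0 suml => [|x [|y [|z l]]] sortl l0 suml;
    rewrite ?mulr0 ?eqseq_cons ?andbF //=.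
  rewrite mulr1 !big_cons big_nil mulr1 /q -mulnb -natrM; congr (_%:R).
  move: sortl l0 suml; rewrite /= !inE /= /geq /= addn0 !andbT => lexy.
  rewrite negb_or => /andP[x0 y0] sumxy; lia.
have {}rc : (r n)`_2 = c [:: maxn i j; minn i j].
  have mem_two : [:: maxn i j; minn i j] \in partns n.
    by rewrite mem_partns /is_partn /= !inE /geq /=; lia.
  rewrite rc coef_sum (bigD1_seq _ mem_two) ?partns_uniq //= coefZ etaE // eqxx mulr1.
  rewrite big_seq_cond big1 ?addr0 // => l /andP[ln /negPf neq].
  by rewrite coefZ etaE // neq mulr0.
have n0 : n%:R != 0 :> K by rewrite ((pcharf0P K).1 charK0); lia.
apply: (mulfI n0); rewrite -rc r_2; case: (i =P j) => [ij|_].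
  have two0 : 2%:R != 0 :> K by apply: natS_neq0.
  by rewrite -ijn ij natrD /=; field.
by rewrite /=; ring.
Qed.

End HCoef.

(** * Alternants *)

(** The variables form a sequence indexed by [nat], so that the same [x] serves for N and N + 1
    variables. *)
Definition alternant (A : comNzRingType) (x : nat -> A) N (l : nat -> nat) : A :=
  \det (\matrix_(i < N, j < N) x i ^+ l j).

(** This says that lam/mu has at most one cell in each column, for [lam] with at most N + 1 rows.
    The bound [c] only makes the set of all [mu] finite. *)
Definition interlace c N (lam : nat -> nat) (mu : {ffun 'I_N -> 'I_c.+1}) : bool :=
  [forall j : 'I_N, (lam j.+1 <= mu j <= lam j)%N].

Definition ext0 c N (mu : {ffun 'I_N -> 'I_c.+1}) (i : nat) : nat :=
  oapp (fun j : 'I_N => mu j : nat) 0%N (insub i).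

Lemma ext0E c N (mu : {ffun 'I_N -> 'I_c.+1}) (j : 'I_N) : ext0 mu j = mu j.
Proof. by rewrite /ext0 valK. Qed.

Lemma ext0_out c N (mu : {ffun 'I_N -> 'I_c.+1}) i : (N <= i)%N -> ext0 mu i = 0%N.
Proof. by move=> leNi; rewrite /ext0 insubF // ltnNge leNi. Qed.

Section Alternant.
Variables (A : comNzRingType) (x : nat -> A).

Lemma eq_alternant N l l' :
  (forall j, (j < N)%N -> l j = l' j) -> alternant x N l = alternant x N l'.
Proof. by move=> eql; congr (\det _); apply/matrixP=> i j; rewrite !mxE eql. Qed.

(** A telescoping sum. With y = x_i and z = x_N the right side is an entry after the column
    operation of the next lemma. *)
Lemma sum_exchange_power (y z : A) m n : (m <= n)%N ->
  (y - z) * \sum_(m <= k < n) y ^+ k * z ^+ (n - k.+1) = y ^+ n - z ^+ (n - m) * y ^+ m.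
Proof.
move=> lemn; rewrite mulr_sumr.
rewrite (eq_big_nat _ _ (F2 := fun k => y ^+ k.+1 * z ^+ (n - k.+1) - y ^+ k * z ^+ (n - k))).
  by rewrite telescope_sumr // subnn expr0 mulr1 [_ * y ^+ m]mulrC.
by move=> k /andP[_ ltkn]; rewrite -[(n - k)%N]subnSK // !exprS; ring.
Qed.

(** From each column but the last, subtract the multiple of the next one that clears its entry in
    the last row. Expanding along that row leaves x_N^(l_N), and x_i - x_N factors out of row i. *)
Lemma alternant_rec N l : (forall j, (j < N)%N -> (l j.+1 <= l j)%N) ->
  alternant x N.+1 l = \prod_(i < N) (x i - x N) * x N ^+ l N *
    \det (\matrix_(i < N, j < N) \sum_(l j.+1 <= m < l j) x i ^+ m * x N ^+ (l j - m.+1)).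
Proof.
move=> decl.
pose B : 'M[A]_N.+1 := \matrix_(i, j) x i ^+ l j.
pose U : 'M[A]_N.+1 := \matrix_(k, j)
  ((k == j)%:R - (k == j.+1 :> nat)%:R * x N ^+ (l j - l j.+1)).
have detU : \det U = 1.
  rewrite det_trig; last first.
    apply/is_trig_mxP => i j ltij; rewrite mxE -val_eqE /= !ltn_eqF ?mul0r ?subr0 //.
    exact: leqW.
  by rewrite big1 // => i _; rewrite mxE eqxx (ltn_eqF (ltnSn _)) mul0r subr0.
rewrite /alternant -/B -[\det B]mulr1 -[X in _ * X = _]detU -det_mulmx.
have BUE i j : (B *m U) i j = x i ^+ l j -
    (if (j < N)%N then x N ^+ (l j - l j.+1) * x i ^+ l j.+1 else 0).
  rewrite mxE; under eq_bigr do rewrite !mxE mulrBr.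
  rewrite sumrB; congr (_ - _).
    rewrite (bigD1 j) //= eqxx mulr1 big1 ?addr0 // => k /negPf->.
    by rewrite mulr0.
  rewrite (eq_bigr (fun k : 'I_N.+1 => if k == j.+1 :> nat
                  then x N ^+ (l j - l j.+1) * x i ^+ l k else 0)); last first.
    by move=> k _; case: eqP => _; rewrite ?mul0r ?mulr0 // mul1r mulrC.
  by rewrite -big_mkcond (big_ord1_eq _ (fun k => x N ^+ (l j - l j.+1) * x i ^+ l k)).
rewrite (expand_det_row _ ord_max) big_ord_recr /= big1 ?add0r; last first.
  move=> j _; rewrite BUE /= ltn_ord -exprD subnK ?decl // subrr mul0r //.
rewrite BUE ltnn subr0 mulrAC mulrC; congr (_ * _).
rewrite /cofactor addnn -signr_odd odd_double expr0 mul1r.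
rewrite -[\prod_(i < N) _](_ : \det (diag_mx (\row_(i < N) (x i - x N))) = _); last first.
  by rewrite det_diag; apply: eq_bigr => i _; rewrite mxE.
rewrite -det_mulmx; congr (\det _); apply/matrixP=> i j.
rewrite mul_diag_mx [LHS]mxE [LHS]mxE BUE !lift_max ltn_ord !mxE sum_exchange_power //.
by apply: decl.
Qed.

(** The determinant is expanded by multilinearity in the columns. In column j the exponent is
    written u + (N - 1 - j), and the summation range becomes lam_(j+1) <= u <= lam_j. *)
Lemma alternant_branch c N (lam : nat -> nat) :
    (forall i, (lam i.+1 <= lam i)%N) -> (lam 0 <= c)%N ->
  alternant x N.+1 (fun j => lam j + (N - j))%N =
  \prod_(i < N) (x i - x N) *
  \sum_(mu : {ffun 'I_N -> 'I_c.+1} | interlace lam mu)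
     x N ^+ (\sum_(j < N) (lam j - mu j) + lam N) *
     alternant x N (fun j => ext0 mu j + (N.-1 - j))%N.
Proof.
move=> declam lamc; have lam_c j : (lam j <= c)%N.
  by elim: j => // j; apply: leq_trans.
rewrite alternant_rec; last by move=> j ltjN; have := declam j; lia.
rewrite subnn addn0 -mulrA; congr (_ * _).
pose H (i j : 'I_N) (u : 'I_c.+1) := x i ^+ (u + (N.-1 - j)) * x N ^+ (lam j - u).
rewrite -det_tr /determinant.
have entryE (s : 'S_N) (j : 'I_N) :
    ((\matrix_(i < N, j < N) (\sum_(lam j.+1 + (N - j.+1) <= m < lam j + (N - j))
         x i ^+ m * x N ^+ (lam j + (N - j) - m.+1)))^T : 'M[A]_N) j (s j) =
    \sum_(u : 'I_c.+1 | (lam j.+1 <= u <= lam j)%N) H (s j) j u.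
  rewrite !mxE; have ltjN := ltn_ord j.
  rewrite big_addn (_ : (_ - _ = (lam j).+1)%N); last by lia.
  rewrite big_geq_mkord /= (big_ord_widen_cond c.+1 (fun i => lam j.+1 <= i)%N
    (fun i => x (s j) ^+ (i + (N - j.+1)) * x N ^+ (lam j + (N - j) - (i + (N - j.+1)).+1)));
    last by rewrite ltnS.
  apply: eq_big => [u|u _]; first by rewrite ltnS.
  by rewrite /H; congr (_ ^+ _ * _ ^+ _); lia.
under eq_bigr => s _ do rewrite (eq_bigr _ (fun j _ => entryE s j)) bigA_distr_big_dep mulr_sumr.
rewrite exchange_big /= mulr_sumr; apply: eq_big => [mu|mu _].
  by apply/familyP/forallP => mui j; have := mui j.
rewrite addnC exprD -mulrA; congr (_ * _).
rewrite /alternant -det_tr /determinant mulr_sumr; apply: eq_bigr => s _.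
rewrite mulrCA; congr (_ * _); rewrite big_split expr_sum mulrC; congr (_ * _).
by apply: eq_bigr => j _; rewrite !mxE ext0E.
Qed.

End Alternant.

(** * Semistandard tableaux and the bialternant formula *)

Section Tableaux.
Variables (r c : nat).
Local Notation box := ('I_r * 'I_c)%type.
Implicit Types (D : {set box}) (p q : box) (lam : nat -> nat).

(* A tableau with entries < N is extended to the whole r x c box by the value N
   outside its shape. *)
Definition tab_valid N (T : {ffun box -> 'I_N.+1}) : bool :=
  [forall p : box, forall q : box,
     ((p.1 == q.1) && (p.2 <= q.2)%N ==> (T p <= T q)%N) &&
     ([&& p.2 == q.2, (p.1 < q.1)%N & (T p < N)%N] ==> (T p < T q)%N)].

Definition tab_shape N m (T : {ffun box -> 'I_N.+1}) : {set box} :=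
  [set p | (T p < m)%N].

Definition yd lam : {set box} := [set p : box | (p.2 < lam p.1)%N].

Lemma tab_validP N (T : {ffun box -> 'I_N.+1}) :
  reflect ((forall i (j j' : 'I_c), (j <= j')%N -> (T (i, j) <= T (i, j'))%N) /\
           (forall (i i' : 'I_r) j, (i < i')%N -> (T (i, j) < N)%N ->
              (T (i, j) < T (i', j))%N)) (tab_valid T).
Proof.
apply: (iffP forallP) => [validT|[rowT colT] [i j]].
  split=> [i j j' lej|i i' j lti ltN].
    have /forallP/(_ (i, j'))/andP[/implyP + _] := validT (i, j).
    by apply; rewrite eqxx.
  have /forallP/(_ (i', j))/andP[_ /implyP] := validT (i, j).
  by apply; rewrite eqxx lti.
apply/forallP => -[i' j']; apply/andP; split; apply/implyP => /=.
  by case/andP=> /eqP-> /rowT.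
by case/and3P=> /eqP->; apply: colT.
Qed.

Lemma yd_row lam i (j j' : 'I_c) : (j <= j')%N -> (i, j') \in yd lam -> (i, j) \in yd lam.
Proof. by rewrite !inE /=; apply: leq_ltn_trans. Qed.

Lemma card_ord_ltn m : (m <= c)%N -> #|[set k : 'I_c | (k < m)%N]| = m.
Proof.
move=> lemc; rewrite -sum1dep_card -(big_ord_widen_cond c xpredT (fun=> 1%N)) //.
by rewrite sum1_card card_ord.
Qed.

Lemma downset_ord (B : {set 'I_c}) :
    (forall j j' : 'I_c, (j <= j')%N -> j' \in B -> j \in B) ->
  forall k : 'I_c, (k \in B) = (k < #|B|)%N.
Proof.
move=> downB k; apply/idP/idP => [kB|].
  rewrite -(@card_ord_ltn k.+1) //; apply: subset_leq_card.
  by apply/subsetP=> j; rewrite inE ltnS => /downB; apply.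
apply: contraLR => kB; rewrite -leqNgt -[X in (_ <= X)%N](card_ord_ltn (ltnW (ltn_ord k))).
apply: subset_leq_card; apply/subsetP=> j jB; rewrite inE ltnNge.
by apply: contra kB => /downB; apply.
Qed.

(** A diagram determines its row lengths as long as it fits into the box; the ambient shape [lam0]
    ensures this. *)
Lemma yd_sub_le lam lam' lam0 j :
    (forall i, (lam i <= lam0 i)%N) -> (lam0 j <= c)%N ->
    (forall i, (r <= i)%N -> lam0 i = 0%N) ->
  yd lam \subset yd lam' -> (lam j <= lam' j)%N.
Proof.
move=> lelam lam0c lam0r /subsetP sub; rewrite leqNgt; apply/negP => lt_j.
have ltr : (j < r)%N.
  by rewrite ltnNge; apply/negP => /lam0r l0; have := lelam j; rewrite l0; lia.
have ltc : (lam' j < c)%N := leq_trans lt_j (leq_trans (lelam j) lam0c).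
by have := sub (Ordinal ltr, Ordinal ltc); rewrite !inE /= lt_j ltnn => /(_ isT).
Qed.

(** Columns increase strictly and start at 0 or above; hence a tableau cannot have more rows than
    letters. *)
Lemma tab_row_le N (T : {ffun box -> 'I_N.+1}) lam p :
    (forall i, (lam i.+1 <= lam i)%N) -> tab_valid T -> tab_shape N T = yd lam ->
  p \in yd lam -> (p.1 <= T p)%N.
Proof.
case: p => -[i ltir] j /= declam /tab_validP[_ colT] shT.
elim: i ltir => // i IHi ltir pD; have ltir' := ltnW ltir.
have pD' : (Ordinal ltir', j) \in yd lam.
  by move: pD; rewrite !inE /= => ltj; apply: leq_trans ltj (declam i).
apply: leq_trans (colT (Ordinal ltir') (Ordinal ltir) j _ _) => //=.
  exact: IHi.
by move: pD'; rewrite -shT inE.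
Qed.

Section GenFun.
Variables (A : comNzRingType) (x : nat -> A).

Definition tab_gf D N : A :=
  \sum_(T : {ffun box -> 'I_N.+1} | tab_valid T && (tab_shape N T == D))
    \prod_(p in D) x (T p).

(** Passing to one more letter turns the filler [N] into a genuine entry on D minus D' and into the
    filler N + 1 outside [D]; the inverse merges both values. The last hypothesis, that D minus D'
    has at most one cell per column, keeps columns strict. *)
Lemma tab_gf_layer D D' N : D' \subset D ->
    (forall i (j j' : 'I_c), (j <= j')%N -> (i, j') \in D -> (i, j) \in D) ->
    (forall (i i' : 'I_r) j, (i < i')%N -> (i, j) \in D -> (i', j) \in D -> (i, j) \in D') ->
  \sum_(T : {ffun box -> 'I_N.+2} |
      [&& tab_valid T, tab_shape N.+1 T == D & tab_shape N T == D'])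
    \prod_(p in D) x (T p) = x N ^+ #|D :\: D'| * tab_gf D' N.
Proof.
move=> sD'D rowD colD.
pose h (T : {ffun box -> 'I_N.+1}) : {ffun box -> 'I_N.+2} :=
  [ffun p => if p \in D then inord (T p) else ord_max].
pose h' (T : {ffun box -> 'I_N.+2}) : {ffun box -> 'I_N.+1} :=
  [ffun p => inord (minn (T p) N)].
have hE T p : h T p = (if p \in D then T p : nat else N.+1) :> nat.
  by rewrite ffunE; case: ifP => // _; rewrite inordK // ltnW ?ltn_ord // ltnS ltn_ord.
have h'E T p : h' T p = minn (T p) N :> nat.
  by rewrite ffunE inordK // ltnS geq_minr.
rewrite (reindex_onto h h') => [|T /and3P[_ /eqP shT _]]; last first.
  apply/ffunP=> p; apply: ord_inj; rewrite hE h'E -shT inE.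
  by move: (T p) => u; have := ltn_ord u; case: ifP; lia.
rewrite /tab_gf mulr_sumr; apply: eq_big => [T|T /andP[/and3P[_ _ /eqP shT] _]]; last first.
  rewrite (big_setID D') /= (setIidPr sD'D) mulrC; congr (_ * _).
    rewrite (eq_bigr (fun=> x N)) ?prodr_const // => p /setDP[pD pD'].
    have : p \notin tab_shape N (h T) by rewrite shT.
    rewrite inE hE pD -leqNgt /=; move: (T p) => u leT; congr x; have := ltn_ord u; lia.
  by apply: eq_bigr => p pD'; rewrite hE (subsetP sD'D).
apply/idP/idP.
  case/andP=> /and3P[/tab_validP[rowT colT] /eqP shT /eqP shT'] /eqP <-.
  apply/andP; split.
    apply/tab_validP; split=> [i j j' lej|i i' j lti].
      by rewrite !h'E; have := rowT i j j' lej; lia.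
    by rewrite !h'E => ltN; have := colT i i' j lti; lia.
  apply/eqP/setP=> p; rewrite inE h'E -shT' !inE; lia.
case/andP=> /tab_validP[rowT colT] /eqP shT.
have TD p : (p \in D') = (T p < N)%N by rewrite -shT inE.
apply/andP; split; first (apply/and3P; split).
- apply/tab_validP; split=> [i j j' lej|i i' j lti].
    rewrite !hE; case: ifP => [Dj|Dj].
      by case: ifP => _; [exact: rowT|rewrite ltnW // ltn_ord].
    by case: ifP => // /(rowD _ _ _ lej); rewrite Dj.
  rewrite !hE; case: ifP => [Dj _|]; last by rewrite ltnn.
  case: ifP => [Dj'|_]; last by rewrite ltn_ord.
  by apply: colT => //; rewrite -TD; apply: colD Dj'.
- apply/eqP/setP=> p; rewrite inE hE; case: ifP => _; last by rewrite ltnn.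
  by rewrite ltn_ord.
- apply/eqP/setP=> p; rewrite inE hE TD.
  case: ifP => [//|pD]; rewrite ltnNge leqnSn /= -TD.
  by apply/esym/negbTE/negP => /(subsetP sD'D); rewrite pD.
apply/eqP/ffunP=> p; apply: ord_inj; rewrite h'E hE; case: ifP => pD.
  by move: (T p) => u; have := ltn_ord u; lia.
have : ~~ (T p < N)%N by rewrite -TD; apply/negP => /(subsetP sD'D); rewrite pD.
by move: (T p) => u; have := ltn_ord u; lia.
Qed.

Lemma tab_gf_last0 D N :
    (forall i (j j' : 'I_c), (j <= j')%N -> (i, j') \in D -> (i, j) \in D) ->
  x N = 0 -> tab_gf D N.+1 = tab_gf D N.
Proof.
move=> rowD xN0; rewrite /tab_gf (bigID (fun T => tab_shape N T == D)) /=.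
rewrite [X in _ + X]big1 ?addr0.
  under eq_bigl do rewrite -andbA.
  by rewrite tab_gf_layer // setDv cards0 expr0 mul1r.
move=> T /andP[/andP[_ /eqP shT] shT'].
have [p pD pT] : exists2 p, p \in D & T p = N :> nat.
  have : ~~ (D \subset tab_shape N T).
    apply: contra shT' => sDT; rewrite eqEsubset sDT andbT; apply/subsetP=> p.
    by rewrite -shT !inE; lia.
  case/subsetPn=> p pD; rewrite inE -leqNgt => leN; exists p => //.
  by move: pD; rewrite -shT inE; lia.
by rewrite (bigD1 p) //= pT xN0 mul0r.
Qed.

(** Tableaux are sorted by the shape [mu] of their entries below N; the remaining cells all carry
    the entry N. *)
Lemma tab_gf_branch N lam :
    (forall i, (lam i.+1 <= lam i)%N) -> (lam 0 <= c)%N ->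
    (forall i, (r <= i)%N -> lam i = 0%N) -> (forall i, (N < i)%N -> lam i = 0%N) ->
  tab_gf (yd lam) N.+1 = \sum_(mu : {ffun 'I_N -> 'I_c.+1} | interlace lam mu)
    x N ^+ #|yd lam :\: yd (ext0 mu)| * tab_gf (yd (ext0 mu)) N.
Proof.
move=> declam lam0 lamr lamN.
have lamc i : (lam i <= c)%N by elim: i => // i; apply: leq_trans.
have declam' i i' : (i <= i')%N -> (lam i' <= lam i)%N.
  by move/subnKC<-; elim: (_ - _)%N => [|d IHd]; rewrite ?addn0 // addnS (leq_trans (declam _)).
(* Rows are indexed by [nat], since [mu] has [N] rows and the box has [r]; rows outside the box are
   empty. *)
pose row (T : {ffun box -> 'I_N.+2}) i : {set 'I_c} :=
  [set k : 'I_c | [exists p in tab_shape N T, (p.1 == i :> nat) && (p.2 == k)]].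
pose muof T : {ffun 'I_N -> 'I_c.+1} := [ffun j : 'I_N => inord #|row T j|].
have muofE T (j : 'I_N) : muof T j = #|row T j| :> nat.
  by rewrite ffunE inordK // ltnS -[X in (_ <= X)%N](card_ord c) max_card.
pose P (T : {ffun box -> 'I_N.+2}) := tab_valid T && (tab_shape N.+1 T == yd lam).
have shE T : P T -> tab_shape N T = yd (ext0 (muof T)).
  case/andP=> validT /eqP shT; have /tab_validP[rowT colT] := validT.
  apply/setP=> -[i j]; rewrite [RHS]inE /=; case: (ltnP i N) => [ltiN|leNi].
    rewrite (ext0E _ (Ordinal ltiN)) muofE /= -downset_ord.
      rewrite [RHS]inE; apply/idP/existsP => [ijT|[[i' j'] /= /and3P[ijT /eqP ii /eqP jj]]].
        by exists (i, j); rewrite ijT !eqxx.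
      by rewrite -jj -(ord_inj ii).
    move=> k k' lek; rewrite !inE => /existsP[[i' j'] /= /and3P[ijT /eqP ii /eqP jj]].
    apply/existsP; exists (i', k); rewrite /= !eqxx ii eqxx /= andbT.
    by move: ijT; rewrite !inE jj; apply: leq_ltn_trans; apply: rowT.
  rewrite ext0_out // ltn0; apply/negbTE/negP => ijT.
  have ijD : (i, j) \in yd lam.
    by rewrite -shT; move: ijT; rewrite !inE => ltT; apply: leq_trans ltT (leqnSn N).
  have := tab_row_le declam validT shT ijD; move: ijT; rewrite inE /=.
  by move: (T (i, j)) => u; lia.
have interT T : P T -> interlace lam (muof T).
  move=> PT; have sh := shE T PT; case/andP: PT => /tab_validP[rowT colT] /eqP shT.
  apply/forallP=> j; rewrite -!ext0E.
  have mu_c : (ext0 (muof T) j <= c)%N by rewrite ext0E -ltnS.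
  have in_sh (i : 'I_r) (k : 'I_c) : (T (i, k) < N)%N = (k < ext0 (muof T) i)%N.
    by have /setP/(_ (i, k)) := sh; rewrite !inE.
  have in_D (i : 'I_r) (k : 'I_c) : (T (i, k) < N.+1)%N = (k < lam i)%N.
    by have /setP/(_ (i, k)) := shT; rewrite !inE.
  (* If mu_j < lam_(j+1), the cell of row j in column mu_j has entry N and a cell of [lam] below it,
     whose entry would exceed N. The other inequality is inclusion of shapes. *)
  apply/andP; split; rewrite leqNgt; apply/negP => lt_mu.
    have ltr : (j.+1 < r)%N by rewrite ltnNge; apply/negP => /lamr lam0'; rewrite lam0' in lt_mu.
    have ltc : (ext0 (muof T) j < c)%N := leq_trans lt_mu (lamc _).
    pose k := Ordinal ltc; pose i1 := Ordinal (ltnW ltr); pose i2 := Ordinal ltr.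
    have T1 : (T (i1, k) < N)%N = false by rewrite in_sh /= ltnn.
    have T2 : (T (i2, k) < N.+1)%N by rewrite in_D.
    have T1' : (T (i1, k) < N.+1)%N by rewrite in_D /= (leq_trans lt_mu).
    have := colT i1 i2 k (ltnSn _) T1'.
    by move: (T (i1, k)) (T (i2, k)) T1 T2 => u v; lia.
  have ltr : (j < r)%N.
    rewrite ltnNge; apply/negP => lerj.
    have : row T j = set0.
      apply/setP=> k; rewrite !inE; apply/existsP => -[[i k'] /= /and3P[_ /eqP ij _]].
      by have := ltn_ord i; rewrite ij ltnNge lerj.
    by move: lt_mu; rewrite ext0E muofE => + row0; rewrite row0 cards0.
  have ltc : (lam j < c)%N := leq_trans lt_mu mu_c.
  have := in_sh (Ordinal ltr) (Ordinal ltc); have := in_D (Ordinal ltr) (Ordinal ltc).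
  rewrite /= ltnn lt_mu; move: (T _) => u; lia.
rewrite {1}/tab_gf (partition_big muof (interlace lam)) //=.
apply: eq_bigr => mu inter_mu; have /forallP inter := inter_mu.
have leml i : (ext0 mu i <= lam i)%N.
  case: (ltnP i N) => [ltiN|leNi]; last by rewrite ext0_out.
  by rewrite (ext0E _ (Ordinal ltiN)); have /andP[] := inter (Ordinal ltiN).
rewrite -tab_gf_layer; last 3 first.
- by apply/subsetP=> p; rewrite !inE => /leq_trans; apply.
- exact: yd_row.
- move=> i i' j lti; rewrite !inE /= => _ ltj.
  case: (ltnP i N) => [ltiN|leNi].
    rewrite (ext0E _ (Ordinal ltiN)); have /andP[le_mu _] := inter (Ordinal ltiN).
    by apply: leq_trans ltj (leq_trans (declam' _ _ lti) le_mu).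
  by move: ltj; rewrite lamN // (leq_ltn_trans leNi).
apply: eq_bigl => T; rewrite andbA -/(P T); case: (boolP (P T)) => //= PT.
rewrite shE //.
apply/eqP/eqP => [->//|eq_yd].
have muTl i : (ext0 (muof T) i <= lam i)%N.
  case: (ltnP i N) => [ltiN|leNi]; last by rewrite ext0_out.
  rewrite (ext0E _ (Ordinal ltiN)).
  by have /forallP/(_ (Ordinal ltiN))/andP[] := interT T PT.
apply/ffunP=> j; apply: ord_inj; rewrite -!ext0E; apply/eqP.
by rewrite eqn_leq; apply/andP; split; apply: (@yd_sub_le _ _ lam) => //; rewrite eq_yd subxx.
Qed.

Lemma sum_ord_support (F : nat -> nat) m n :
    (forall i, (m <= i)%N -> F i = 0%N) -> (forall i, (n <= i)%N -> F i = 0%N) ->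
  (\sum_(i < m) F i = \sum_(i < n) F i)%N.
Proof.
have widen k k' : (k <= k')%N -> (forall i, (k <= i)%N -> F i = 0%N) ->
    (\sum_(i < k) F i = \sum_(i < k') F i)%N.
  move=> lek F0; rewrite (big_ord_widen k' F lek) big_mkcond; apply: eq_bigr => i _.
  by case: ltnP => // /F0.
by move=> Fm Fn; case: (leqP m n) => [le|/ltnW le]; [|apply/esym]; apply: widen.
Qed.

Lemma card_yd lam : (forall i, (lam i <= c)%N) -> #|yd lam| = (\sum_(i < r) lam i)%N.
Proof.
move=> lamc; rewrite -sum1_card (eq_bigl (fun p : box => (p.2 < lam p.1)%N)); last first.
  by move=> p; rewrite inE.
rewrite -(pair_big_dep xpredT (fun (i : 'I_r) (j : 'I_c) => (j < lam i)%N) (fun _ _ => 1%N)).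
by apply: eq_bigr => i _; rewrite /= sum1dep_card card_ord_ltn.
Qed.

(** Identifies the exponent of x_N in the branching of tableaux with the one in the branching of
    alternants. *)
Lemma card_yd_branch N lam (mu : {ffun 'I_N -> 'I_c.+1}) :
    (forall i, (lam i <= c)%N) -> interlace lam mu ->
    (forall i, (r <= i)%N -> lam i = 0%N) -> (forall i, (N < i)%N -> lam i = 0%N) ->
  #|yd lam :\: yd (ext0 mu)| = (\sum_(j < N) (lam j - mu j) + lam N)%N.
Proof.
move=> lamc /forallP inter lamr lamN.
have leml i : (ext0 mu i <= lam i)%N.
  case: (ltnP i N) => [ltiN|leNi]; last by rewrite ext0_out.
  by rewrite (ext0E _ (Ordinal ltiN)); have /andP[] := inter (Ordinal ltiN).
have sub : yd (ext0 mu) \subset yd lam.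
  by apply/subsetP=> p; rewrite !inE => /leq_trans; apply.
rewrite cardsD (setIidPr sub) !card_yd // => [|i]; last exact: leq_trans (leml i) _.
rewrite -sumnB // (@sum_ord_support (fun i => lam i - ext0 mu i)%N r N.+1).
- rewrite big_ord_recr /= ext0_out // subn0; congr (_ + _)%N.
  by apply: eq_bigr => j _; rewrite ext0E.
- by move=> i /lamr->.
- by move=> i /lamN->.
Qed.

Lemma tab_gf_ge N lam p : (forall i, (lam i.+1 <= lam i)%N) ->
  p \in yd lam -> (N <= p.1)%N -> tab_gf (yd lam) N = 0.
Proof.
move=> declam pD leN; rewrite /tab_gf big1 // => T /andP[validT /eqP shT].
have := tab_row_le declam validT shT pD.
by move: pD; rewrite -shT inE ltnNge => /negP + leT; case; apply: leq_trans leT.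
Qed.

(** Both sides satisfy the same recursion over interlacing [mu], with the product of the x_i - x_N
    as common factor. *)
Lemma tab_bialternant N lam :
    (forall i, (lam i.+1 <= lam i)%N) -> (lam 0 <= c)%N ->
    (forall i, (r <= i)%N -> lam i = 0%N) -> (forall i, (N <= i)%N -> lam i = 0%N) ->
  alternant x N (fun j => N.-1 - j)%N * tab_gf (yd lam) N =
  alternant x N (fun j => lam j + (N.-1 - j))%N.
Proof.
elim: N lam => [|N IHN] lam declam lam0 lamr lamN.
  rewrite /alternant !det_mx00 mul1r /tab_gf.
  have yd0 : yd lam = set0 by apply/setP=> p; rewrite !inE lamN.
  rewrite yd0 (big_pred1 [ffun=> ord0]) ?big_set0 // => T.
  have -> : T = [ffun=> ord0] by apply/ffunP=> p; rewrite ffunE ord1.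
  rewrite /= eqxx; apply/andP; split.
    by apply/tab_validP; split=> [i j j' _|i i' j _]; rewrite !ffunE.
  by apply/eqP/setP=> p; rewrite !inE.
have lamc i : (lam i <= c)%N by elim: i => // i; apply: leq_trans.
(* The Vandermonde recursion is the branching of the zero shape with bound 0, where only mu = 0
   interlaces. *)
have -> : alternant x N.+1 (fun j => N - j)%N =
          \prod_(i < N) (x i - x N) * alternant x N (fun j => N.-1 - j)%N.
  rewrite (@alternant_branch _ x 0 N (fun=> 0%N)) //; congr (_ * _).
  rewrite (big_pred1 [ffun=> ord0]) => [|mu]; last first.
    have -> : mu = [ffun=> ord0] by apply/ffunP=> p; rewrite ffunE ord1.
    by rewrite /= eqxx; apply/forallP=> j; rewrite ffunE.
  rewrite big1 // expr0 mul1r; apply: eq_alternant => j ltjN.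
  by rewrite (ext0E _ (Ordinal ltjN)) ffunE.
rewrite (@alternant_branch _ x c) // tab_gf_branch // -mulrA; congr (_ * _).
rewrite mulr_sumr; apply: eq_bigr => mu inter_mu.
rewrite card_yd_branch // mulrCA; have /forallP inter := inter_mu.
have muE i (ltiN : (i < N)%N) : (lam i.+1 <= ext0 mu i <= lam i)%N.
  by rewrite (ext0E _ (Ordinal ltiN)); exact: inter (Ordinal ltiN).
congr (_ * _); apply: IHN => [i||i leri|i]; last exact: ext0_out.
- case: (ltnP i.+1 N) => [ltiN|leNi]; last by rewrite ext0_out.
  have /andP[_ le1] := muE _ ltiN; have /andP[le2 _] := muE _ (ltnW ltiN).
  exact: leq_trans le1 le2.
- case: (posnP N) => [N0|N0]; first by rewrite ext0_out ?N0.
  by have /andP[_ le0] := muE _ N0; exact: leq_trans le0 lam0.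
case: (ltnP i N) => [ltiN|leNi]; last exact: ext0_out.
by have /andP[_] := muE _ ltiN; rewrite lamr // leqn0 => /eqP.
Qed.

End GenFun.
End Tableaux.

(** * Schur functions as quotients of alternants *)

Section Schur.
Variable K : fieldType.
Implicit Types (l : seq nat).

Definition xvar N (i : nat) : {mpoly K[N]} := oapp (fun k : 'I_N => 'X_k) 0 (insub i).

Lemma xvarE N (i : 'I_N) : xvar N i = 'X_i.
Proof. by rewrite /xvar valK. Qed.

Lemma xvar_out N i : (N <= i)%N -> xvar N i = 0.
Proof. by move=> leNi; rewrite /xvar insubF // ltnNge leNi. Qed.

Local Notation boxl l := ('I_(size l) * 'I_(head 0%N l))%type.
Local Notation ydl l := (@yd (size l) (head 0%N l) (nth 0%N l)).

(** Extending a filling of the cells by the value [N] is injective, and its image consists of the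
    valid tables whose shape is the diagram of [l]. *)
Lemma schur_tab l N : schur K l N = tab_gf (xvar N) (ydl l) N.
Proof.
pose h (T : {ffun cell l -> 'I_N}) : {ffun boxl l -> 'I_N.+1} :=
  [ffun p => if insub p is Some q then inord (T q) else ord_max].
have hval T (q : cell l) : h T (val q) = T q :> nat.
  by rewrite ffunE valK inordK // ltnW // ltnS ltn_ord.
have hout T p : p \notin ydl l -> h T p = N :> nat.
  by rewrite inE => pD; rewrite ffunE insubN.
pose P (T : {ffun boxl l -> 'I_N.+1}) := tab_valid T && (tab_shape N T == ydl l).
have inj_h : injective h.
  move=> T1 T2 eqh; apply/ffunP=> q; apply: ord_inj.
  by rewrite -!hval eqh.
have shh T : tab_shape N (h T) = ydl l.
  apply/setP=> p; rewrite [LHS]inE; case: (boolP (p \in ydl l)) => pD; last first.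
    by rewrite hout // ltnn.
  have pD' : (p.2 < nth 0%N l p.1)%N by move: pD; rewrite inE.
  by rewrite -[p](SubK (cell l) pD') hval ltn_ord.
have validh T : tab_valid (h T) = is_ssyt T.
  apply/tab_validP/forallP => [[rowT colT] p|ssT].
    apply/forallP=> q; case Ep : (val p) => [i j]; case Eq : (val q) => [i' j'].
    rewrite -!hval Ep Eq; apply/andP; split; apply/implyP => /andP[/eqP].
      by move=> <- /rowT.
    by move=> <- lti; apply: colT => //; rewrite -Ep hval.
  have ssT' p q := forallP (ssT p) q.
  split=> [i j j' lej|i i' j lti].
    case: (boolP ((i, j') \in ydl l)) => [pD|/hout->]; last by rewrite -ltnS ltn_ord.
    have pD1 : (j' < nth 0%N l i)%N by move: pD; rewrite inE.
    have pD2 : (j < nth 0%N l i)%N := leq_ltn_trans lej pD1.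
    have := ssT' (Sub (i, j) pD2) (Sub (i, j') pD1).
    by rewrite -!hval /= eqxx lej => /andP[].
  case: (boolP ((i, j) \in ydl l)) => [pD _|/hout->]; last by rewrite ltnn.
  have pD1 : (j < nth 0%N l i)%N by move: pD; rewrite inE.
  case: (boolP ((i', j) \in ydl l)) => [qD|/hout->].
    have qD1 : (j < nth 0%N l i')%N by move: qD; rewrite inE.
    have := ssT' (Sub (i, j) pD1) (Sub (i', j) qD1).
    by rewrite -!hval /= eqxx lti => /andP[].
  by rewrite -[(i, j)](@SubK _ _ (cell l) (i, j) pD1) hval.
rewrite /schur /tab_gf.
have -> : \sum_(T : {ffun boxl l -> 'I_N.+1} | P T) \prod_(p in ydl l) xvar N (T p) =
    \sum_(T in h @: [set T | is_ssyt T]) \prod_(p in ydl l) xvar N (T p).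
  apply: eq_bigl => T; rewrite /P; apply/idP/imsetP => [/andP[validT /eqP shT]|[T1 ssT ->]].
    have TN (q : cell l) : (T (val q) < N)%N.
      by have /setP/(_ (val q)) := shT; rewrite !inE => ->; apply: (valP q).
    have hT : T = h [ffun q => Ordinal (TN q)].
      apply/ffunP=> p; apply: ord_inj.
      case: (boolP (p \in ydl l)) => pD.
        have pD' : (p.2 < nth 0%N l p.1)%N by move: pD; rewrite inE.
        by rewrite -[p](SubK (cell l) pD') hval ffunE.
      rewrite hout //; move: pD; rewrite -shT inE.
      by move: (T p) => u; have := ltn_ord u; lia.
    by exists [ffun q => Ordinal (TN q)]; rewrite // inE -validh -hT.
  by rewrite validh shh eqxx andbT; move: ssT; rewrite inE.
rewrite big_imset /=; last by move=> T1 T2 _ _; apply: inj_h.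
apply: eq_big => [T|T _]; first by rewrite inE.
rewrite (reindex_omap (fun q : cell l => val q) insub) /=; last first.
  by move=> p; rewrite inE => pD; rewrite insubT.
apply: eq_big => [q|q _]; last by rewrite hval xvarE.
by rewrite inE (valP q) valK eqxx.
Qed.

Section Partition.
Variables (l : seq nat).
Hypothesis sortl : sorted geq l.

Lemma nth_sorted_geq i : (nth 0 l i.+1 <= nth 0 l i)%N.
Proof.
case: (ltnP i.+1 (size l)) => [lti|le]; last by rewrite nth_default.
by apply: (sorted_ltn_nth (rev_trans leq_trans)) => //; rewrite inE ltnW.
Qed.

Lemma schur_bialternant N : (size l <= N)%N ->
  alternant (xvar N) N (fun j => N.-1 - j)%N * schur K l N =
  alternant (xvar N) N (fun j => nth 0 l j + (N.-1 - j))%N.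
Proof.
move=> leN; rewrite schur_tab; apply: tab_bialternant.
- exact: nth_sorted_geq.
- by rewrite nth0.
- by move=> i lei; rewrite nth_default.
by move=> i lei; rewrite nth_default // (leq_trans leN).
Qed.

Lemma schur_small N : 0%N \notin l -> (N < size l)%N -> schur K l N = 0.
Proof.
move=> l0 ltN; rewrite schur_tab.
have lt0 : (0 < head 0 l)%N.
  by case: l l0 ltN => // k l'; rewrite inE negb_or eq_sym -lt0n => /andP[].
apply: (@tab_gf_ge _ _ _ _ _ _ (Ordinal ltN, Ordinal lt0)) => //=.
  exact: nth_sorted_geq.
rewrite inE /= lt0n; apply: contra l0 => /eqP <-; exact: mem_nth.
Qed.

End Partition.

(** Since [xvar N] is 0 at index N, the sum in N variables may be taken over N + 1 letters, and then
    the two sums agree term by term. *)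
Lemma drop_last_var_schur l N : drop_last_var (schur K l N.+1) = schur K l N.
Proof.
rewrite !schur_tab -[RHS]tab_gf_last0; last 2 first.
- by move=> i j j'; apply: yd_row.
- by rewrite xvar_out.
rewrite /tab_gf /drop_last_var rmorph_sum; apply: eq_bigr => T _.
rewrite rmorph_prod; apply: eq_bigr => p _ /=.
move: (T p) => u; case: (ltnP u N.+1) => [ltu|leu]; last first.
  by rewrite !xvar_out ?rmorph0 // ltnW.
rewrite (xvarE (Ordinal ltu)) comp_mpolyXU -tnth_nth tnth_mktuple.
case: unliftP => [j ju|maxu] /=.
  by rewrite (_ : u = j :> nat) ?xvarE // -[LHS]/(val (Ordinal ltu)) ju /= /bump leqNgt ltn_ord.
by rewrite xvar_out // -[X in (_ <= X)%N]/(val (Ordinal ltu)) maxu.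
Qed.

Lemma card_cell l : sorted geq l -> #|cell l| = sumn l.
Proof.
move=> sortl; rewrite card_sig -[LHS](_ : #|ydl l| = _); last first.
  by apply: eq_card => p; rewrite !inE.
rewrite card_yd; first by rewrite sumnE (big_nth 0%N) big_mkord.
move=> i; rewrite -nth0; elim: i => // i; apply: leq_trans.
exact: nth_sorted_geq.
Qed.

Lemma homog_schur l N : sorted geq l -> schur K l N \is (sumn l).-homog.
Proof.
move=> sortl; apply: rpred_sum => T _.
rewrite mprodXE dhomogX /= mdeg_sum (eq_bigr (fun=> 1%N)) => [|p _]; last exact: mdeg1.
by rewrite sum1_card card_cell.
Qed.

Lemma alternantE N (v : nat -> nat) : alternant (xvar N) N v =
  \sum_(s : 'S_N) (-1) ^+ s *: 'X_[[multinom v (s i) | i < N]].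
Proof.
rewrite /alternant /determinant; apply: eq_bigr => s _.
rewrite -mul_mpolyC rmorphXn rmorphN rmorph1; congr (_ * _).
rewrite [RHS]mpolyXE_id; apply: eq_bigr => i _.
by rewrite !mxE xvarE mnmE.
Qed.

Lemma msym_alternant N (v : nat -> nat) (s : 'S_N) :
  msym s (alternant (xvar N) N v) = (-1) ^+ s * alternant (xvar N) N v.
Proof.
rewrite /alternant -[LHS](det_map_mx (msym s)) -det_perm -det_mulmx -row_permE.
congr (\det _); apply/matrixP=> i j; rewrite !mxE rmorphXn /= !xvarE.
by rewrite /msym mmapX mmap1U.
Qed.

Definition strict_decr N (v : nat -> nat) :=
  forall i j, (i < j)%N -> (j < N)%N -> (v j < v i)%N.

(** An increasing self-map of ['I_N] lies above the identity; apply this to [s] and to its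
    inverse. *)
Lemma perm_increasing N (s : 'S_N) :
  (forall i j : 'I_N, (i < j)%N -> (s i < s j)%N) -> s = 1%g.
Proof.
have ge_id (t : 'S_N) : (forall i j : 'I_N, (i < j)%N -> (t i < t j)%N) ->
    forall i : 'I_N, (i <= t i)%N.
  move=> incr [i]; elim: i => // i IHi ltiN /=.
  apply: leq_ltn_trans (IHi (ltnW ltiN)) _.
  exact: incr.
move=> incr; apply/permP=> i; rewrite perm1; apply: ord_inj; apply/eqP.
rewrite eqn_leq ge_id // andbT; rewrite -[X in (_ <= nat_of_ord X)%N](permK s i).
apply: ge_id => {}i j ltij; rewrite ltnNge; apply/negP; rewrite leq_eqVlt => /orP[/eqP|].
  by move/ord_inj/perm_inj => eij; rewrite eij ltnn in ltij.
by move/incr; rewrite !permKV ltnNge ltnW.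
Qed.

(** Among the rearrangements of a strictly decreasing sequence only the trivial one is decreasing,
    so at most one term of the determinant contributes. *)
Lemma mcoeff_alternant N (v w : nat -> nat) :
    strict_decr N v -> strict_decr N w ->
  (alternant (xvar N) N v)@_[multinom w i | i < N] =
  [forall i : 'I_N, v i == w i]%:R.
Proof.
move=> dv dw; rewrite alternantE raddf_sum (bigD1 1%g) //= big1 ?addr0; last first.
  move=> s neq; rewrite mcoeffZ mcoeffX; case: eqP => [/mnmP vw|_]; last by rewrite mulr0.
  case/eqP: neq; apply: perm_increasing => i j ltij; rewrite ltnNge; apply/negP.
  have := dw i j ltij (ltn_ord j); have := vw i; have := vw j; rewrite !mnmE => <- <- ltv.
  rewrite leq_eqVlt => /orP[/eqP sij|/dv]; first by rewrite sij ltnn in ltv.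
  by move/(_ (ltn_ord _)); rewrite ltnNge ltnW.
rewrite mcoeffZ mcoeffX odd_perm1 expr0 mul1r; congr (_%:R); congr nat_of_bool.
apply/eqP/forallP => [/mnmP vw i|vw].
  by have := vw i; rewrite !mnmE perm1 => ->.
by apply/mnmP=> i; rewrite !mnmE perm1; apply/eqP/vw.
Qed.

Lemma strict_decr_delta N : strict_decr N (fun j => N.-1 - j)%N.
Proof. by move=> i j; lia. Qed.

Lemma alternant_delta_neq0 N : alternant (xvar N) N (fun j => N.-1 - j)%N != 0.
Proof.
apply/eqP=> /(congr1 (mcoeff [multinom (N.-1 - i)%N | i < N])).
rewrite (mcoeff_alternant (@strict_decr_delta N) (@strict_decr_delta N)) mcoeff0.
by rewrite (_ : [forall i, _]) => [/eqP|]; [rewrite oner_eq0|apply/forallP=> i].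
Qed.

(** Both alternants change by the sign of the permutation, and the denominator cancels in an
    integral domain. *)
Lemma schur_sym l N : sorted geq l -> 0%N \notin l -> schur K l N \is symmetric.
Proof.
move=> sortl l0; case: (leqP (size l) N) => [leN|ltN]; last by rewrite schur_small ?rpred0.
apply/issymP=> s; apply: (mulfI (alternant_delta_neq0 N)).
have sgn0 : (-1) ^+ s != 0 :> {mpoly K[N]} by rewrite signr_eq0.
apply: (mulfI sgn0); rewrite mulrA -msym_alternant -msymM schur_bialternant //.
by rewrite msym_alternant.
Qed.

Lemma homog_symfun_schur n l : is_partn n l -> homog_symfun n (schur K l).
Proof.
case/and3P=> sortl l0 /eqP <-; split=> N.
- exact: schur_sym.
- exact: homog_schur.
exact: drop_last_var_schur.
Qed.

End Schur.

(** * Expansions in Schur functions *)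

Section SchurCoef.
Variable K : fieldType.

Lemma partn_eq_nth (l l' : seq nat) : 0%N \notin l -> 0%N \notin l' ->
  (forall i, nth 0%N l i = nth 0%N l' i) -> l = l'.
Proof.
have size_le k k' : 0%N \notin k -> (forall i, nth 0%N k i = nth 0%N k' i) ->
    (size k <= size k')%N.
  move=> k0 eqk; rewrite leqNgt; apply/negP => /(mem_nth 0%N).
  by rewrite eqk nth_default // (negPf k0).
move=> l0 l0' eql; apply: (eq_from_nth (x0 := 0%N)) => // ; apply/eqP.
by rewrite eqn_leq !size_le.
Qed.

Lemma strict_decr_partn N (l : seq nat) : sorted geq l ->
  strict_decr N (fun j => nth 0 l j + (N.-1 - j))%N.
Proof.
move=> sortl i j ltij ltjN; suff : (nth 0 l j <= nth 0 l i)%N by lia.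
rewrite -(subnKC (ltnW ltij)); elim: (j - i)%N => [|d IHd]; first by rewrite addn0.
by rewrite addnS (leq_trans (nth_sorted_geq sortl _)).
Qed.

(** Any [N] not below the length of [l] will do, because longer shapes vanish in [N] variables: rows
    need one variable, hooks k + 1. *)
Lemma schur_coef n (f : varfam K) c l N :
    is_expansion (@schur K) n f c -> is_partn n l -> (size l <= N)%N ->
  (alternant (xvar K N) N (fun j => N.-1 - j)%N * f N)
     @_[multinom (nth 0 l i + (N.-1 - i))%N | i < N] = c l.
Proof.
move=> expc ln leN; have /and3P[sortl l0 _] := ln; have lP := ln.
rewrite -mem_partns in lP; rewrite expc mulr_sumr raddf_sum /=.
rewrite (bigD1_seq l) ?partns_uniq //= big_seq_cond big1 ?addr0 => [|l'].
  rewrite -scalerAr mcoeffZ schur_bialternant //.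
  rewrite (@mcoeff_alternant K N _ _ (strict_decr_partn (N := N) sortl) (strict_decr_partn (N := N) sortl)).
  by rewrite (_ : [forall i, _]) ?mulr1 //; apply/forallP=> i.
case/andP; rewrite mem_partns => /and3P[sortl' l0' _] neq.
rewrite -scalerAr mcoeffZ; case: (leqP (size l') N) => [leN'|ltN]; last first.
  by rewrite schur_small // mulr0 mcoeff0 mulr0.
rewrite schur_bialternant //.
rewrite (@mcoeff_alternant K N _ _ (strict_decr_partn (N := N) sortl') (strict_decr_partn (N := N) sortl)).
case: forallP => [eql|]; last by rewrite mulr0.
case/eqP: neq; apply: partn_eq_nth => // i; case: (ltnP i N) => [ltiN|leNi].
  by have := eql (Ordinal ltiN); rewrite /= eqn_add2r => /eqP.
by rewrite !nth_default ?(leq_trans _ leNi).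
Qed.

Lemma bcoef_expansion (B : seq nat -> varfam K) n f :
  (exists c, is_expansion B n f c) -> is_expansion B n f (bcoef B n f).
Proof. exact: epsilon_spec. Qed.

Hypothesis charK0 : [pchar K] =i pred0.

(* The transition matrix from Schur functions to the h-basis is square, and it is
   invertible because Schur functions are linearly independent. *)
Lemma schur_expansion n (f : varfam K) :
  homog_symfun n f -> exists c, is_expansion (@schur K) n f c.
Proof.
move=> homf; pose d := size (partns n); pose part (i : 'I_d) := tnth (in_tuple (partns n)) i.
have sumP (A : zmodType) (F : seq nat -> A) : \sum_(l <- partns n) F l = \sum_i F (part i).
  by rewrite [LHS](big_tnth _ _ (partns n)).
have partP i : is_partn n (part i) by rewrite -mem_partns mem_tnth.
have hexp g : homog_symfun n g -> is_expansion (@hfun K) n g (bcoef (@hfun K) n g).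
  by move=> homg; apply/bcoef_expansion/hfun_expansion.
pose M := \matrix_(i < d, j < d) bcoef (@hfun K) n (schur K (part i)) (part j).
have schurM N (v : 'rV[K]_d) : \sum_i v 0 i *: schur K (part i) N =
    \sum_j (v *m M) 0 j *: hfun K (part j) N.
  under [RHS]eq_bigr do rewrite mxE scaler_suml.
  rewrite [RHS]exchange_big; apply: eq_bigr => i _ /=.
  rewrite (hexp _ (homog_symfun_schur K (partP i))) sumP scaler_sumr.
  by apply: eq_bigr => j _; rewrite !mxE scalerA.
have part_inj : injective part by apply/tuple_uniqP/partns_uniq.
have extend (v : 'rV[K]_d) : exists c : seq nat -> K, forall i, c (part i) = v 0 i.
  exists (fun l => if [pick i | part i == l] is Some i then v 0 i else 0) => i.
  case: pickP => [j /eqP/part_inj->//|/(_ i)]; by rewrite eqxx.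
have unitM : M \in unitmx.
  rewrite -row_free_unit; apply: inj_row_free => v vM0.
  have [c cv] := extend v.
  have exp0 : is_expansion (@schur K) n (fun N => 0) c.
    move=> N; rewrite sumP (eq_bigr (fun i => v 0 i *: schur K (part i) N)); last first.
      by move=> i _; rewrite /= cv.
    by rewrite schurM vM0 big1 // => j _; rewrite mxE scale0r.
  apply/rowP=> i; rewrite mxE -cv -(schur_coef exp0 (partP i) (leqnn _)).
  by rewrite mulr0 mcoeff0.
pose w : 'rV[K]_d := \row_j bcoef (@hfun K) n f (part j).
have [c cv] := extend (w *m invmx M); exists c => N.
rewrite (hexp f homf) !sumP (eq_bigr (fun i => w 0 i *: hfun K (part i) N)); last first.
  by move=> i _; rewrite mxE.
rewrite [RHS](eq_bigr (fun i => (w *m invmx M) 0 i *: schur K (part i) N)); last first.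
  by move=> i _; rewrite /= cv.
by rewrite schurM mulmxKV.
Qed.

Lemma row_partnP n : is_partn n (row_partn n).
Proof. by case: n => [|n] //=; rewrite /is_partn /= addn0 eqxx. Qed.

Lemma schur_coef_row n (f : varfam K) c : is_expansion (@schur K) n f c ->
  c (row_partn n) = (f 1%N)@_[multinom n | i < 1].
Proof.
move=> expc; rewrite -(schur_coef (N := 1) expc (row_partnP n)); last by case: (n).
rewrite /alternant det_mx11 mxE expr0 mul1r; congr (_@__).
by apply/mnmP=> i; rewrite !mnmE ord1 addn0; case: (n).
Qed.

Lemma mcoeff_mulX N (p : {mpoly K[N]}) (m w : 'X_{1..N}) :
  ('X_[m] * p)@_w = if (m <= w)%MM then p@_(w - m)%MM else 0.
Proof.
rewrite mulrC; case: ifP => [lemw|/negP nle]; first by rewrite -{1}(submK lemw) addmC mcoeffMX.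
apply/eqP; rewrite mcoeff_eq0 (perm_mem (msuppMX _ _)); apply/negP => /mapP[m' _ wE].
by apply: nle; rewrite wE lem_addr.
Qed.

(** The term of the permutation s in a_delta shifts the exponent l + delta to l_i - i + s(i), and
    R_n has the product of the a's as coefficient there. A negative exponent corresponds to a zero
    entry. *)
Lemma schur_coef_Rfun (a : fps K) n c l N :
    is_expansion (@schur K) n (Rfun a n) c -> is_partn n l -> (size l <= N)%N ->
  c l = \det (\matrix_(i < N, j < N)
    if (i <= nth 0 l i + j)%N then a (nth 0 l i + j - i)%N else 0).
Proof.
move=> expc ln leN; rewrite -(schur_coef expc ln leN) alternantE mulr_suml raddf_sum.
rewrite /determinant; apply: eq_bigr => s _ /=; rewrite -scalerAl mcoeffZ; congr (_ * _).
have /and3P[_ _ /eqP suml] := ln.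
set w := [multinom _ | i < N]; set m := [multinom _ | i < N].
rewrite mcoeff_mulX; case: ifP => [/mnm_lepP lemw|/negP nle].
  have lesl (i : 'I_N) : (i <= nth 0 l i + s i)%N.
    by have := lemw i; rewrite !mnmE; have := ltn_ord i; have := ltn_ord (s i); lia.
  rewrite mcoeff_Rfun ifT.
    apply: eq_bigr => i _; rewrite !mxE lesl mnmE !mnmE; congr a.
    by have := lesl i; have := ltn_ord i; have := ltn_ord (s i); lia.
  (* The degree condition holds for every s, as permuting delta preserves its sum. *)
  have : (mdeg (w - m) + mdeg m = n + mdeg m)%N.
    rewrite -mdegD submK; last exact/mnm_lepP.
    have -> : mdeg m = (\sum_(i < N) (N.-1 - i))%N.
      rewrite mdegE [RHS](reindex_inj (@perm_inj _ s)).
      by apply: eq_bigr => i _; rewrite mnmE.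
    rewrite mdegE -suml sumnE (big_nth 0%N) big_mkord.
    rewrite (@sum_ord_support (nth 0%N l) (size l) N).
    - by rewrite -big_split; apply: eq_bigr => i _; rewrite mnmE.
    - by move=> i lei; rewrite nth_default.
    by move=> i lei; rewrite nth_default // (leq_trans leN).
  by move/eqP; rewrite eqn_add2r.
apply/esym/eqP/prodf_eq0.
have [i lti] : exists i : 'I_N, ~~ (m i <= w i)%N.
  by apply/existsP; rewrite -negb_forall; apply/negP => /forallP lemw; apply/nle/mnm_lepP.
exists i => //; rewrite mxE ifF //; apply/negbTE; move: lti; rewrite !mnmE.
by have := ltn_ord i; have := ltn_ord (s i); lia.
Qed.

End SchurCoef.

(** * Hooks *)

Section Hooks.
Variables (K : fieldType) (a : fps K).
Hypothesis a0 : a 0%N = 1.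

(** The shape is a first row [m] followed by rows of length 1. The value m = 0 is allowed and occurs
    as a boundary term. *)
Definition hook_entry m i j : K :=
  let li := if i == 0%N then m else 1%N in
  if (i <= li + j)%N then a (li + j - i)%N else 0.

Definition hook_det m k : K := \det (\matrix_(i < k.+1, j < k.+1) hook_entry m i j).

Lemma hook_det0 m : hook_det m 0 = a m.
Proof. by rewrite /hook_det det_mx11 mxE /hook_entry /= addn0 subn0. Qed.

Lemma hook_entry0 m j : hook_entry m 0 j = a (m + j)%N.
Proof. by rewrite /hook_entry /= subn0. Qed.

Lemma hook_entryS m i j : hook_entry m i.+1 j = if (i <= j)%N then a (j - i)%N else 0.
Proof. by rewrite /hook_entry /= add1n ltnS subSS. Qed.

(** The first column is a_m, 1, 0, ..., 0. Deleting row 0 leaves the column shape, deleting row 1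
    lengthens the first row by one. *)
Lemma hook_detS m k : hook_det m k.+1 = a m * hook_det 1 k - hook_det m.+1 k.
Proof.
rewrite {1}/hook_det (expand_det_col _ ord0) !big_ord_recl big1 => [|i _]; last first.
  by rewrite mxE !lift0 hook_entryS mul0r.
rewrite addr0 !mxE lift0 hook_entry0 hook_entryS addn0 /= subnn a0 mul1r.
rewrite /cofactor /= /bump /= addn0 expr0 mul1r expr1 mulN1r; congr (a m * _ - _).
  congr (\det _); apply/matrixP=> i j; rewrite !mxE !lift0 hook_entryS.
  by case: (i : nat) => [|i']; rewrite ?hook_entry0 ?hook_entryS ?subn0 ?add1n // ltnS subSS.
congr (\det _); apply/matrixP=> i j; rewrite !mxE !lift0 /=.
by case: (i : nat) => [|i'] /=; rewrite ?hook_entry0 ?addnS ?addSn // /bump /= !add1n !hook_entryS.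
Qed.

Definition col_coef n : K := if n is n'.+1 then hook_det 1 n' else 1.

(** Counterpart of the Pieri rule for h_m e_(k+1), which has two hooks as summands. *)
Lemma mul_col_coef m k : a m * col_coef k.+1 = hook_det m k.+1 + hook_det m.+1 k.
Proof. by rewrite hook_detS subrK. Qed.

Lemma col_coef_inv : col_coef = fps_inv (fps_dil (-1) a).
Proof.
apply: fps_inv_unique; first by rewrite /fps_dil expr0 mul1r.
apply: functional_extensionality => -[|n].
  by rewrite /fps_mul big_ord1 /fps_dil expr0 a0 !mul1r.
(* By [mul_col_coef] the inner terms of the product telescope as G i - G (i + 1); the two end values
   cancel the first and last terms. *)
pose G i := (-1) ^+ i.+1 * hook_det i.+1 (n - i).
rewrite /fps_mul big_ord_recl /fps_dil expr0 a0 !mul1r.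
rewrite big_ord_recr /= subnn mulr1.
rewrite (eq_bigr (fun i : 'I_n => G i - G i.+1)) => [|i _].
  rewrite -(big_mkord xpredT (fun i => G i - G i.+1)) -[\sum_(0 <= _ < _) _]opprK -sumrN.
  rewrite (eq_bigr (fun i => G i.+1 - G i)) => [|i _]; last by rewrite opprB.
  rewrite telescope_sumr // /G subn0 subnn hook_det0 /bump /= add1n !expr1.
  by rewrite /fps_one /=; ring.
rewrite /bump /= add1n subSS -(subnSK (ltn_ord i)) -mulrA mul_col_coef /G.
by rewrite -(subnSK (ltn_ord i)) [(-1) ^+ i.+2]exprS; ring.
Qed.

(** The coefficient of u^j in P_n is a_(n-j) times a column coefficient, which splits into two hook
    coefficients; regrouping them yields the factor 1 + u. *)
Lemma hook_series n : (0 < n)%N ->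
  let P : fps {poly K} :=
    fps_mul (fun m => (a m)%:P) (fps_inv (fps_dil (- 'X) (fun m => (a m)%:P))) in
  (size (P n) <= n.+1)%N /\ P n = (1 + 'X) * \sum_(k < n) hook_det (n - k) k *: 'X^k.
Proof.
move=> n0 P.
have invE : fps_inv (fps_dil (- 'X) (fun m => (a m)%:P)) = fun j => col_coef j *: 'X^j.
  apply/esym/fps_inv_unique; first by rewrite /fps_dil expr0 mul1r a0.
  apply: functional_extensionality => m; rewrite /fps_mul.
  transitivity (\sum_(i < m.+1) (fps_dil (-1) a i * col_coef (m - i)%N) *: 'X^m : {poly K}).
    apply: eq_bigr => i _; rewrite /fps_dil.
    have -> : 'X^m = 'X^i * 'X^(m - i) :> {poly K} by rewrite -exprD subnKC ?leq_ord.
    rewrite -!mul_polyC exprNn !rmorphM /=.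
    by rewrite rmorphXn rmorphN rmorph1; ring.
  rewrite -scaler_suml col_coef_inv.
  have := fps_mulV (f := fps_dil (-1) a); rewrite /fps_dil expr0 mul1r => /(_ a0).
  move/(congr1 (fun g : fps K => g m)); rewrite /fps_mul /fps_one => ->.
  by case: m => [|m]; rewrite ?scale1r ?expr0 // scale0r.
have PE : P n = \sum_(j < n.+1) (a (n - j)%N * col_coef j) *: 'X^j.
  rewrite /P invE fps_mulC; apply: eq_bigr => j _.
  by rewrite -!mul_polyC polyCM; ring.
split.
  by rewrite PE -(poly_def n.+1 (fun j => a (n - j)%N * col_coef j)) size_poly.
rewrite PE mulrDl mul1r mulr_sumr; case: n n0 {P PE} => // n _.
(* The top power of u would belong to a hook with empty first row; its determinant vanishes. *)
have hook00 : hook_det 0 n.+1 = 0 by rewrite hook_detS a0 mul1r subrr.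
transitivity (\sum_(j < n.+2) hook_det (n.+1 - j) j *: 'X^j
              + \sum_(j < n.+1) hook_det (n.+1 - j) j *: 'X^(j.+1) : {poly K}).
  rewrite !(big_ord_recl n.+1) /= subn0 hook_det0 mulr1 -addrA; congr (_ + _).
  rewrite -big_split; apply: eq_bigr => j _ /=.
  by rewrite /bump /= add1n subSS subSn ?leq_ord // -scalerDl mul_col_coef.
rewrite big_ord_recr /= subnn hook00 scale0r addr0; congr (_ + _).
by apply: eq_bigr => j _; rewrite -scalerAr exprS.
Qed.

End Hooks.

Lemma sorted_nseq1 m k : (0 < m)%N -> sorted geq (m :: nseq k 1%N).
Proof. by elim: k m => //= k IHk m m0; rewrite /geq /= m0 IHk. Qed.

Lemma hook_partnP n k : (k < n)%N -> is_partn n ((n - k)%N :: nseq k 1%N).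
Proof.
move=> ltkn; have nk : (0 < n - k)%N by rewrite subn_gt0.
rewrite /is_partn sorted_nseq1 //= sumn_nseq mul1n subnK 1?ltnW // eqxx andbT.
by rewrite inE negb_or mem_nseq andbF andbT eq_sym -lt0n.
Qed.

(** * Coefficients at hooks and rows *)

Section Consequences.
Variable K : fieldType.
Hypothesis charK0 : [pchar K] =i pred0.

Lemma schur_coef_hook (a : fps K) n k : a 0%N = 1 -> (k < n)%N ->
  bcoef (@schur K) n (Rfun a n) ((n - k)%N :: nseq k 1%N) = hook_det a (n - k) k.
Proof.
move=> a0 ltkn; have expc := bcoef_expansion (schur_expansion charK0 (homog_symfun_Rfun n a0)).
rewrite (schur_coef_Rfun (N := k.+1) expc (hook_partnP ltkn)) /= ?size_nseq //.
congr (\det _); apply/matrixP=> i j; rewrite !mxE /hook_entry.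
have -> // : nth 0%N ((n - k)%N :: nseq k 1%N) i = if i == 0%N :> nat then (n - k)%N else 1%N.
by case: i => -[|i] //= ltik; rewrite nth_nseq -ltnS ltik.
Qed.

(** In one variable every h_l of degree n becomes x^n, so the coefficient of x^n adds up the
    h-coefficients. *)
Lemma schur_coef_row_hfun n (f : varfam K) : homog_symfun n f ->
  bcoef (@schur K) n f (row_partn n) = \sum_(l <- partns n) bcoef (@hfun K) n f l.
Proof.
move=> homf; have expc := bcoef_expansion (schur_expansion charK0 homf).
have exph := bcoef_expansion (hfun_expansion charK0 homf).
rewrite (schur_coef_row expc) exph raddf_sum big_seq [RHS]big_seq; apply: eq_bigr => l.
rewrite mem_partns => /and3P[_ _ /eqP <-] /=; rewrite mcoeffZ.
have -> : hfun K l 1 = 'X_[[multinom sumn l | i < 1]].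
  rewrite /hfun; elim: l => [|k l IHl].
    by rewrite big_nil -mpolyX0; congr 'X_[_]; apply/mnmP=> i; rewrite !mnmE.
  rewrite big_cons IHl; have -> : hsym K k 1 = 'X_[[multinom k | i < 1]].
    apply/mpolyP=> m; rewrite hsymE mcoeff_Rfun mcoeffX big1_eq mdegE big_ord1.
    have -> : ([multinom k | _ < 1] == m) = (m ord0 == k); last by case: eqP.
    apply/eqP/eqP => [<-|mk]; first by rewrite mnmE.
    by apply/mnmP=> i; rewrite mnmE ord1 mk.
  by rewrite -mpolyXD; congr 'X_[_]; apply/mnmP=> i; rewrite !mnmE.
by rewrite mcoeffX eqxx mulr1.
Qed.

(** Both sides have constant term 1 and the same logarithmic derivative. This reconciles the two
    forms of the answer in (c). *)
Lemma fps_inv_exp (g : fps K) : g 0%N = 0 ->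
  fps_inv (fps_dil (-1) (fps_exp g)) = fps_exp (fps_opp (fps_dil (-1) g)).
Proof.
move=> g0; have exp0 h : fps_exp h 0%N = 1 :> K.
  by rewrite /fps_exp /fps_comp big_ord1 invr1 mulr1.
have dil0 : fps_dil (-1) (fps_exp g) 0%N = 1 by rewrite /fps_dil expr0 mul1r exp0.
have g0' : fps_opp (fps_dil (-1) g) 0%N = 0 by rewrite /fps_opp /fps_dil g0 mulr0 oppr0.
apply: (fps_logder_unique charK0 (c := fun n => n%:R * fps_opp (fps_dil (-1) g) n)).
- have := fps_logder_inv dil0 (fps_logder_dil (-1) (fps_logder_exp charK0 g0)).
  congr fps_logder; apply: functional_extensionality => n.
  by rewrite /fps_opp /fps_dil mulrN mulrCA.
- exact: fps_logder_exp.
- have /(congr1 (fun h : fps K => h 0%N)) := fps_mulV dil0.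
  by rewrite /fps_mul big_ord1 dil0 mul1r.
exact: exp0.
Qed.

End Consequences.

Theorem theorem2p7 (K : fieldType) (charK0 : [pchar K] =i pred0)
    (a : fps K) (a0 : a 0%N = 1)
    (b : nat -> K) (logF : forall n, (0 < n)%N -> fps_log a n = b n / n%:R) :
  let R := Rfun a in
  (* (a) *)
  [/\ (forall n, bcoef (@schur K) n (R n) (row_partn n) = a n) /\
      (forall n (f : varfam K), homog_symfun n f ->
         bcoef (@schur K) n f (row_partn n) = \sum_(l <- partns n) bcoef (@hfun K) n f l),
  (* (b) *)
      forall n, bcoef (@schur K) n (R n) (nseq n 1%N) =
                fps_inv (fps_dil (-1) a) n,
  (* (c) *)
      [/\ forall k, (0 < k)%N -> forall n,
            bcoef (@hfun K) (k * n) (R (k * n)%N) (nseq n k) =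
            fps_exp (fps_opp (fps_dil (-1) (fps_logser (fun i => b (k * i)%N)))) n,
          forall k, (0 < k)%N -> forall n,
            bcoef (@hfun K) (k * n) (R (k * n)%N) (nseq n k) =
            fps_inv (fps_dil (-1) (fps_exp (fps_logser (fun i => b (k * i)%N)))) n
        & forall n, (0 < n)%N -> bcoef (@hfun K) n (R n) [:: n] = b n],
  (* (d) *)
      forall i j n, (0 < i)%N -> (0 < j)%N -> (i + j)%N = n ->
        bcoef (@hfun K) n (R n) [:: maxn i j; minn i j] =
        if i == j then (b i ^+ 2 - b n) / 2%:R else b i * b j - b n
    & (* (e) *)
      (forall k n, eval_ones k (R n) = fps_pow a k n) /\
  (* (f) *)
      (let P : fps {poly K} :=
         fps_mul (fun m => (a m)%:P) (fps_inv (fps_dil (- 'X) (fun m => (a m)%:P))) in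
       forall n, (0 < n)%N ->
         [/\ (size (P n) <= n.+1)%N,
             (1 + 'X %| P n)%R
           & P n %/ (1 + 'X) =
             \sum_(k < n) bcoef (@schur K) n (R n) ((n - k)%N :: nseq k 1%N) *: 'X^k])].
Proof.
(* The value b 0 is arbitrary, while a logarithmic derivative must vanish at 0. *)
move=> R; pose b' n := if n is 0 then 0 else b n.
have ab : fps_logder a b'.
  have := fps_logder_log charK0 a0; congr fps_logder.
  apply: functional_extensionality => -[|n]; first by rewrite mul0r.
  by rewrite logF // mulrC divfK ?natS_neq0.
have homR n : homog_symfun n (R n) := homog_symfun_Rfun n a0.
have exps n : is_expansion (@schur K) n (R n) (bcoef (@schur K) n (R n)).
  exact/bcoef_expansion/schur_expansion.
have exph n : is_expansion (@hfun K) n (R n) (bcoef (@hfun K) n (R n)).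
  exact/bcoef_expansion/hfun_expansion.
have row_coef n : bcoef (@schur K) n (R n) (row_partn n) = a n.
  rewrite (schur_coef_row (exps n)) mcoeff_Rfun mdegE !big_ord1 mnmE eqxx.
  by [].
have rect_coef k n : (0 < k)%N -> bcoef (@hfun K) (k * n) (R (k * n)%N) (nseq n k) =
    fps_exp (fps_opp (fps_dil (-1) (fps_logser (fun i => b (k * i)%N)))) n.
  move=> k0; rewrite (coef_hfun_rect charK0 a0 ab k0 (exph _)); congr (fps_exp (fps_opp (fps_dil _ _)) n).
  by apply: functional_extensionality => -[|i] //=; rewrite /b' mulnS; case: (k) k0.
split.
- by split=> // n f; apply: schur_coef_row_hfun.
- case=> [|n]; rewrite -col_coef_inv //; first by rewrite (row_coef 0%N).
  by have := schur_coef_hook charK0 a0 (ltnSn n); rewrite subSnn.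
- split=> [k k0 n|k k0 n|n n0]; first exact: rect_coef.
    by rewrite rect_coef // fps_inv_exp.
  (* The partition (n) is the rectangle with a single part n, so the coefficient of t in the
     exponential is wanted. *)
  have := rect_coef n 1%N n0; rewrite muln1 /= => ->.
  have g0 : fps_opp (fps_dil (-1) (fps_logser (fun i => b (n * i)%N))) 0%N = 0.
    by rewrite /fps_opp /fps_dil mulr0 oppr0.
  have := fps_logderE 1 (fps_logder_exp charK0 g0) _.
  rewrite mul1r => -> ; last by rewrite /fps_exp /fps_comp big_ord1 invr1 mulr1.
  rewrite big_ord1 mul1r /fps_opp /fps_dil /= expr1 mulN1r opprK divr1 muln1.
  by rewrite /fps_exp /fps_comp big_ord1 invr1 !mulr1.
- move=> i j n i0 j0 ijn; rewrite (coef_hfun_two charK0 a0 ab i0 j0 ijn (exph n)).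
  by move: i0 j0 ijn => {}/prednK<- /prednK<- <-.
split=> [k n|P n n0]; first exact: eval_ones_Rfun.
have [sizeP PE] := hook_series a0 n0; split=> //; first by rewrite /P PE dvdp_mulr.
have X1 : 1 + 'X != 0 :> {poly K} by rewrite addrC -size_poly_gt0 size_XaddC.
rewrite /P PE mulKp //; apply: eq_bigr => k _.
by rewrite schur_coef_hook.
Qed.
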